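(* Suppose the revival periods are in resonance: there are nonzero rationals $\frac{p_1}{q_1},\frac{p_2}{q_2},\frac{p_{12}}{q_{12}}$ with $\frac{p_1}{q_1}T_{rev_1}=\frac{p_2}{q_2}T_{rev_2}=\frac{p_{12}}{q_{12}}T_{rev_{12}}=:T_{frac}$. Let $r_j:=p_{12}q_j$, $s_j:=q_{12}p_j$ ($j=1,2$), let $\ell_1,\ell_2\geq1$ be integers such that for all $(n,m)\in\mathbb{Z}^2$ $$\frac{\ell_1^2p_1}{q_1}+\frac{2p_1\ell_1}{q_1}n+\frac{p_1r_1\ell_1}{s_1q_1}m\in\mathbb{Z},\qquad \frac{\ell_2^2p_2}{q_2}+\frac{2p_2\ell_2}{q_2}m+\frac{p_2r_2\ell_2}{s_2q_2}n\in\mathbb{Z},$$ and let $\alpha$ be a real number with $\alpha>1-2\min(\delta_1,\delta_2)$. Then there is a family of $\ell_1\ell_2$ complex numbers $(c_{k_1,k_2})_{0\leq k_1\leq\ell_1-1,\,0\leq k_2\leq\ell_2-1}$ (depending on $h$) such that, uniformly for $t\in[0,h^\alpha]$, $$\mathbf{a_2}(t+T_{frac})=\sum_{k_1=0}^{\ell_1-1}\sum_{k_2=0}^{\ell_2-1}c_{k_1,k_2}\,\psi_{cl}\Big(t+T_{frac}+\frac{k_1}{\ell_1}T_{scl_1},\,t+T_{frac}+\frac{k_2}{\ell_2}T_{scl_2}\Big)+O\big(h^{\alpha+2\min(\delta_1,\delta_2)-1}\big).$$ Moreover $$c_{k_1,k_2}=e^{-\frac{2i\pi k_1n_0}{\ell_1}}e^{-\frac{2i\pi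 k_2m_0}{\ell_2}}b_{k_1,k_2},\qquad b_{k_1,k_2}=\langle\theta,\phi^{k_1,k_2}\rangle:=\frac{1}{\ell_1\ell_2}\sum_{n=0}^{\ell_1-1}\sum_{m=0}^{\ell_2-1}\theta_{n,m}\overline{\phi^{k_1,k_2}_{n,m}},$$ where $\theta_{n,m}:=e^{-2i\pi\left(\frac{p_1}{q_1}(n-n_0)^2+\frac{p_{12}}{q_{12}}(n-n_0)(m-m_0)+\frac{p_2}{q_2}(m-m_0)^2\right)}$ and $\phi^{k_1,k_2}_{n,m}:=e^{-\frac{2i\pi k_1n}{\ell_1}}e^{-\frac{2i\pi k_2m}{\ell_2}}$.
   Context: Setting. Fix $\omega_1,\omega_2>0$, a polynomial $F\in\mathbb{R}[X,Y]$ not depending on $h$, a point $(E_1,E_2)\in\,]0,1]^2$, exponents $0<\delta_i<\delta_i'<1$ ($i=1,2$) and a nonnegative, not identically zero function $\chi\in\mathcal{S}(\mathbb{R}^2)$. $h>0$ is a small parameter; asymptotics are for $h\to0^+$. For integers $n,m$ put $\tau_n:=\omega_1h(n+\tfrac12)$, $\mu_m:=\omega_2h(m+\tfrac12)$. Let $n_0=n_0(h)$ (resp. $m_0=m_0(h)$) be the integer in $\mathbb{N}=\{0,1,2,\dots\}$ minimizing $|\tau_n-E_1|$ (resp. $|\mu_m-E_2|$), assumed unique. For $(n,m)\in\mathbb{Z}^2$ put $$a_{n,m}:=K_h\,\chi\Big(\frac{\tau_n-\tau_{n_0}}{h^{\delta_1'}},\frac{\mu_m-\mu_{m_0}}{h^{\delta_2'}}\Big),\qquad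 K_h:=\Big\|\chi\Big(\frac{\tau_n-\tau_{n_0}}{h^{\delta_1'}},\frac{\mu_m-\mu_{m_0}}{h^{\delta_2'}}\Big)\Big\|_{\ell^2(\mathbb{N}^2)}^{-1},$$ so that $\sum_{n,m\in\mathbb{N}}|a_{n,m}|^2=1$ ($h$ small enough). Assume $\frac{\partial F}{\partial X},\frac{\partial F}{\partial Y},\frac{\partial^2F}{\partial X^2},\frac{\partial^2F}{\partial X\partial Y},\frac{\partial^2F}{\partial Y^2}$ are all nonzero at $(E_1,E_2)$. Semi-classical periods: $T_{scl_1}:=\frac{2\pi}{\omega_1\frac{\partial F}{\partial X}(\tau_{n_0},\mu_{m_0})}$, $T_{scl_2}:=\frac{2\pi}{\omega_2\frac{\partial F}{\partial Y}(\tau_{n_0},\mu_{m_0})}$ (well defined for small $h$). Revival periods: $$T_{rev_1}:=\frac{4\pi}{h\,\omega_1^2\frac{\partial^2F}{\partial X^2}(E_1,E_2)},\quad T_{rev_2}:=\frac{4\pi}{h\,\omega_2^2\frac{\partial^2F}{\partial Y^2}(E_1,E_2)},\quad T_{rev_{12}}:=\frac{4\pi}{h\,\omega_1\omega_2\frac{\partial^2F}{\partial X\partial Y}(E_1,E_2)}.$$ Define $$\mathbf{a_2}(t):=\sum_{(n,m)\in\mathbb{N}^2}|a_{n,m}|^2e^{-2i\pi t\left(\frac{n-n_0}{T_{scl_1}}+\frac{m-m_0}{T_{scl_2}}+\frac{(n-n_0)^2}{T_{rev_1}}+\frac{(m-m_0)^2}{T_{rev_2}}+\frac{(n-n_0)(m-m_0)}{T_{rev_{12}}}\right)},$$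 $$\psi_{cl}(t_1,t_2):=\sum_{(n,m)\in\mathbb{N}^2}|a_{n,m}|^2e^{-2i\pi t_1\frac{n-n_0}{T_{scl_1}}-2i\pi t_2\frac{m-m_0}{T_{scl_2}}}.$$ The two conditions on $\ell_1,\ell_2$ express that $\theta_{n,m}$ is $\ell_1$-periodic in $n$ and $\ell_2$-periodic in $m$. *)

(* Defs.v *)
From HB Require Import structures.
From mathcomp Require Import all_boot all_order all_algebra polyXY.
From mathcomp Require Import all_classical all_reals all_analysis.
From mathcomp Require Import complex.
From mathcomp.analysis.showcase Require summability.

Set Implicit Arguments.
Unset Strict Implicit.
Unset Printing Implicit Defensive.

Import Order.TTheory GRing.Theory Num.Theory.
Import numFieldNormedType.Exports.

Local Open Scope ring_scope.

Section Schwartz.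
Variable R : realType.

Definition axis (second : bool) : R * R := if second then (0, 1) else (1, 0).

Definition iter_partial (s : seq bool) (f : R * R -> R) : R * R -> R :=
  foldr (fun b g => fun x => 'D_(axis b) g x) f s.

(* Differentiability of every iterated partial derivative amounts to
   smoothness. *)
Definition schwartz (f : R * R -> R) : Prop :=
  forall s : seq bool,
    (forall x : R * R, differentiable (iter_partial s f) x) /\
    (forall a b : nat, exists C : R, forall x : R * R,
       `| x.1 ^+ a * x.2 ^+ b * iter_partial s f x | <= C).

End Schwartz.

Section BivariatePolynomials.
Variable R : realType.

(* In F.[x, y] the outer indeterminate of F is evaluated at x, so it plays the
   role of X; the coefficients of F are polynomials in Y. *)
Definition partialX (F : {poly {poly R}}) : {poly {poly R}} := deriv F.
Definition partialY (F : {poly {poly R}}) : {poly {poly R}} :=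
  map_poly (@deriv R) F.

End BivariatePolynomials.

Section WavePackets.
Variable R : realType.

Definition expi (x : R) : R[i] := Complex (cos x) (sin x).

(* Unconditional summation over nat * nat, i.e. the limit of the sums over
   finite subsets. *)
Definition rsum2 (u : nat * nat -> R) : R := summability.sum u.
Definition csum2 (u : nat * nat -> R[i]) : R[i] :=
  summability.sum (u : nat * nat -> R[i]^o).

(* tau_n for omega = omega1, and mu_n for omega = omega2 *)
Definition level (omega h : R) (n : int) : R := omega * h * (n%:~R + 2^-1).

Definition unique_nearest (omega h E : R) (n0 : nat) : Prop :=
  forall n : nat, n != n0 ->
    `| level omega h n0%:Z - E | < `| level omega h n%:Z - E |.

Definition profile (omega1 omega2 delta1' delta2' : R) (chi : R * R -> R)
    (h : R) (n0 m0 : nat) (n m : int) : R :=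
  chi ((level omega1 h n - level omega1 h n0%:Z) / h `^ delta1',
       (level omega2 h m - level omega2 h m0%:Z) / h `^ delta2').

Definition normalization (omega1 omega2 delta1' delta2' : R)
    (chi : R * R -> R) (h : R) (n0 m0 : nat) : R :=
  (Num.sqrt (rsum2 (fun nm =>
     `| profile omega1 omega2 delta1' delta2' chi h n0 m0
          nm.1%:Z nm.2%:Z | ^+ 2)))^-1.

Definition coeff (omega1 omega2 delta1' delta2' : R) (chi : R * R -> R)
    (h : R) (n0 m0 : nat) (n m : int) : R :=
  normalization omega1 omega2 delta1' delta2' chi h n0 m0 *
  profile omega1 omega2 delta1' delta2' chi h n0 m0 n m.

Definition Tscl1 (omega1 omega2 : R) (F : {poly {poly R}}) (h : R)
    (n0 m0 : nat) : R :=
  2 * pi / (omega1 *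
    (partialX F).[level omega1 h n0%:Z, level omega2 h m0%:Z]).

Definition Tscl2 (omega1 omega2 : R) (F : {poly {poly R}}) (h : R)
    (n0 m0 : nat) : R :=
  2 * pi / (omega2 *
    (partialY F).[level omega1 h n0%:Z, level omega2 h m0%:Z]).

Definition Trev1 (omega1 : R) (F : {poly {poly R}}) (E1 E2 h : R) : R :=
  4 * pi / (h * omega1 ^+ 2 * (partialX (partialX F)).[E1, E2]).

Definition Trev2 (omega2 : R) (F : {poly {poly R}}) (E1 E2 h : R) : R :=
  4 * pi / (h * omega2 ^+ 2 * (partialY (partialY F)).[E1, E2]).

Definition Trev12 (omega1 omega2 : R) (F : {poly {poly R}}) (E1 E2 h : R) : R :=
  4 * pi / (h * omega1 * omega2 * (partialX (partialY F)).[E1, E2]).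

Definition a2 (omega1 omega2 : R) (F : {poly {poly R}})
    (E1 E2 delta1' delta2' : R) (chi : R * R -> R) (h : R) (n0 m0 : nat)
    (t : R) : R[i] :=
  csum2 (fun nm =>
    let dn : R := nm.1%:R - n0%:R in
    let dm : R := nm.2%:R - m0%:R in
    (`| coeff omega1 omega2 delta1' delta2' chi h n0 m0
          nm.1%:Z nm.2%:Z | ^+ 2)%:C%C *
    expi (- (2 * pi * t *
      (dn / Tscl1 omega1 omega2 F h n0 m0 +
       dm / Tscl2 omega1 omega2 F h n0 m0 +
       dn ^+ 2 / Trev1 omega1 F E1 E2 h +
       dm ^+ 2 / Trev2 omega2 F E1 E2 h +
       dn * dm / Trev12 omega1 omega2 F E1 E2 h)))).

Definition psi_cl (omega1 omega2 : R) (F : {poly {poly R}})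
    (delta1' delta2' : R) (chi : R * R -> R) (h : R) (n0 m0 : nat)
    (t1 t2 : R) : R[i] :=
  csum2 (fun nm =>
    (`| coeff omega1 omega2 delta1' delta2' chi h n0 m0
          nm.1%:Z nm.2%:Z | ^+ 2)%:C%C *
    expi (- (2 * pi * t1 *
             ((nm.1%:R - n0%:R) / Tscl1 omega1 omega2 F h n0 m0))
          - 2 * pi * t2 *
             ((nm.2%:R - m0%:R) / Tscl2 omega1 omega2 F h n0 m0))).

End WavePackets.

Section FiniteFourier.
Variable R : realType.

Definition theta (p1 q1 p2 q2 p12 q12 : int) (n0 m0 : nat) (n m : int) : R[i] :=
  let dn : R := n%:~R - n0%:R in
  let dm : R := m%:~R - m0%:R in
  expi (- (2 * pi * (p1%:~R / q1%:~R * dn ^+ 2 +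
                     p12%:~R / q12%:~R * (dn * dm) +
                     p2%:~R / q2%:~R * dm ^+ 2))).

Definition phi (l1 l2 k1 k2 : nat) (n m : int) : R[i] :=
  expi (- (2 * pi * k1%:R * n%:~R / l1%:R)) *
  expi (- (2 * pi * k2%:R * m%:~R / l2%:R)).

Definition inner (l1 l2 : nat) (u v : int -> int -> R[i]) : R[i] :=
  (l1%:R * l2%:R)^-1 *
  \sum_(n < l1) \sum_(m < l2) u n%:Z m%:Z * (v n%:Z m%:Z)^*%C.

End FiniteFourier.

(* Main.v *)
Require Import Defs.
From HB Require Import structures.
From mathcomp Require Import all_boot all_order all_algebra polyXY finmap.
From mathcomp Require Import all_classical all_reals all_analysis.
From mathcomp Require Import complex ring lra.
From mathcomp.analysis.showcase Require Import summability.

Set Implicit Arguments.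
Unset Strict Implicit.
Unset Printing Implicit Defensive.

Import Order.TTheory GRing.Theory Num.Theory.
Import numFieldNormedType.Exports.

Local Open Scope ring_scope.
Local Open Scope classical_set_scope.

(* The weights w = |a|^2 form a probability on the lattice whose second moment
   about (n0, m0) is O(h^(2 min(delta1, delta2) - 2)): Schwartz decay of chi is
   traded for powers of h using the gaps delta_i' - delta_i, while the
   normalization only needs one lattice point at which chi is bounded below.
   At time t + Tfrac the quadratic phase splits as theta(n, m) times
   exp(-2 i pi t Q(n, m)) with |Q| = O(h (dn^2 + dm^2)), where dn = n - n0 and
   dm = m - m0.  Replacing the second factor by 1 costs
   t h O(h^(2 min(delta1, delta2) - 2)), and the periodic theta is the finite
   Fourier sum of the phi^(k1, k2), each of which shifts the two classical times
   by k1 Tscl1 / l1 and k2 Tscl2 / l2. *)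

#[local] Existing Instance totally_filter.

(** * Unconditional convergence of dominated real and complex families *)

Section Summation.
Variables (R : realType) (I : choiceType).
Implicit Types (A B : {fset I}) (f g : I -> R) (u v : I -> R[i]).

Lemma partial_sum_mono g A B : (forall i, 0 <= g i) -> (A `<=` B)%fset ->
  partial_sum g A <= partial_sum g B.
Proof.
move=> g0 AB; rewrite /partial_sum -!(big_seq_fsetE _ _ xpredT).
rewrite [leRHS](big_fsetID _ (mem A)) /=.
have -> : [fset x in B | x \in A]%fset = A.
  apply/fsetP => x; rewrite !inE/= andbC; case: (boolP (x \in A)) => //= xA.
  by rewrite (fsubsetP AB).
by rewrite lerDl; apply: sumr_ge0.
Qed.

(** The limit is the supremum of the finite sums: a nearly optimal finite set stays nearly optimal
    when enlarged. *)
Lemma nonneg_partial_sum_cvg g M : (forall i, 0 <= g i) ->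
    (forall A, partial_sum g A <= M) ->
  exists l : R, partial_sum g @ totally --> l.
Proof.
move=> g0 gM; pose E := range (partial_sum g); exists (sup E).
have supE : has_sup E.
  split; first by exists (partial_sum g fset0), fset0.
  by exists M => _ [A _ <-].
apply/cvgrPdist_le => e e0.
have [_ [A _ <-] Ae] := sup_adherent e0 supE.
exists A => // B /= AB.
have BE : partial_sum g B <= sup E by apply: ub_le_sup; [exact: supE.2|exists B].
have := partial_sum_mono g0 AB.
rewrite ger0_norm ?subr_ge0 //; lra.
Qed.

Lemma nonneg_partial_sum_le_lim g (l : R) A : (forall i, 0 <= g i) ->
  partial_sum g @ totally --> l -> partial_sum g A <= l.
Proof.
move=> g0 gl; apply/ler_addgt0Pr => e e0.
have [B _ /(_ (A `|` B)%fset (fsubsetUr _ _))/=] := (cvgrPdist_le _ _).1 gl e e0.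
have := partial_sum_mono g0 (fsubsetUl A B).
rewrite ler_norml => ? /andP[? ?]; lra.
Qed.

(** Write [f] as [(f + g) - g]: both families are nonnegative with bounded finite sums, so the
    monotone case applies to each. *)
Lemma dominated_partial_sum_cvg f g M : (forall i, `|f i| <= g i) ->
    (forall A, partial_sum g A <= M) ->
  exists l : R, partial_sum f @ totally --> l.
Proof.
move=> fg gM.
have g0 i : 0 <= g i by apply: le_trans (fg i).
have [l gl] := nonneg_partial_sum_cvg g0 gM.
have fg0 i : 0 <= f i + g i by have := fg i; rewrite ler_norml; lra.
have [l' fgl] : exists l' : R, partial_sum (fun i => f i + g i) @ totally --> l'.
  apply: (@nonneg_partial_sum_cvg _ (2 * M)) => // A.
  have : partial_sum (fun i => f i + g i) A <= partial_sum (fun i => g i + g i) A.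
    by apply: ler_sum => i _; have := fg (val i); rewrite ler_norml; lra.
  have -> : partial_sum (fun i => g i + g i) A = partial_sum g A + partial_sum g A.
    exact: big_split.
  by have := gM A; lra.
exists (l' - l); rewrite (_ : partial_sum f =
  partial_sum (fun i => f i + g i) - partial_sum g); first exact: cvgB fgl gl.
apply/funext => A; apply: (canRL (addrK _)); apply: esym.
exact: big_split.
Qed.

Lemma normc_le_ReIm (z : R[i]) :
  `|z| <= (`|complex.Re z| + `|complex.Im z|)%:C%C.
Proof.
case: z => x y; rewrite normc_def lecR /=.
rewrite -(ler_pXn2r (n := 2)) ?nnegrE ?sqrtr_ge0 ?addr_ge0 //.
rewrite sqr_sqrtr ?addr_ge0 ?sqr_ge0 // -(real_normK (num_real x)).
rewrite -(real_normK (num_real y)).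
by have := mulr_ge0 (normr_ge0 x) (normr_ge0 y); nra.
Qed.

Lemma dominated_complex_partial_sum_cvg u g M :
    (forall i, `|complex.Re (u i)| <= g i) ->
    (forall i, `|complex.Im (u i)| <= g i) ->
    (forall A, partial_sum g A <= M) ->
  exists l : R[i]^o, partial_sum (u : I -> R[i]^o) @ totally --> l.
Proof.
move=> ug1 ug2 gM.
have [x xP] := dominated_partial_sum_cvg ug1 gM.
have [y yP] := dominated_partial_sum_cvg ug2 gM.
(* A positive element of [R[i]] is real, so the tolerance can be halved between the real and the
   imaginary part. *)
exists (Complex x y); apply/cvgrPdist_le => -[e e']; rewrite ltcE /= => /andP[/eqP -> e0].
have e20 : 0 < e / 2 by rewrite divr_gt0.
near=> A.
have -> : partial_sum (u : I -> R[i]^o) A =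
    Complex (partial_sum (fun i => complex.Re (u i)) A)
            (partial_sum (fun i => complex.Im (u i)) A).
  rewrite /partial_sum; apply: (big_rec3 (fun a b c => c = Complex a b)) => //.
  by move=> i a b c _ ->; case: (u (val i)).
apply: (le_trans (normc_le_ReIm _)); rewrite lecR /=.
rewrite [e]splitr lerD //; near: A.
- exact: (cvgrPdist_le _ _).1 xP _ e20.
- exact: (cvgrPdist_le _ _).1 yP _ e20.
Unshelve. all: by end_near.
Qed.

Lemma norm_lim_partial_sum_le u (l : R[i]^o) (b : R[i]) :
    partial_sum (u : I -> R[i]^o) @ totally --> l ->
    (forall A, `|\sum_(i : A) u (val i)| <= b) -> `|l| <= b.
Proof.
move=> ul ub; apply/ler_addgt0Pr => e e0.
have [A _ /(_ A (fsubset_refl _))/=] := (cvgrPdist_le _ _).1 ul e e0.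
move=> lA; rewrite -[l](subrK (partial_sum (u : I -> R[i]^o) A)).
by rewrite addrC (le_trans (ler_normD _ _)) // lerD // ub.
Qed.

End Summation.

(** * The exponential on the unit circle *)

Section UnitCircle.
Variable R : realType.
Implicit Types x y : R.

Lemma expiD x y : expi (x + y) = expi x * expi y.
Proof. by rewrite /expi cosD sinD /GRing.mul /= [sin x * cos y + _]addrC. Qed.

Lemma expi0 : expi (0 : R) = 1.
Proof. by rewrite /expi cos0 sin0. Qed.

Lemma expi_conj x : (expi x)^*%C = expi (- x).
Proof. by rewrite /expi cosN sinN. Qed.

Lemma norm_expi x : `|expi x| = 1.
Proof. by rewrite normc_def /= cos2Dsin2 sqrtr1. Qed.

Lemma expi_natmul x n : expi (n%:R * x) = expi x ^+ n.
Proof.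
elim: n => [|n IH]; first by rewrite mul0r expi0 expr0.
by rewrite exprS -IH -expiD -natr1 mulrDl mul1r addrC.
Qed.

Lemma expi_2pi_nat n : expi (2 * pi * n%:R : R) = 1.
Proof.
rewrite mulrC expi_natmul (_ : expi _ = 1) ?expr1n //.
by rewrite /expi mulrC mulr_natr cos2pi sin2pi.
Qed.

Lemma expi_2pi_int y : y \is a Num.int -> expi (2 * pi * y) = 1.
Proof.
case/intrP => -[n|n] ->; first exact: expi_2pi_nat.
by rewrite NegzE mulrNz mulrN -expi_conj expi_2pi_nat /= oppr0.
Qed.

(** If the cosine were 1, the identity [1 - cos x = 2 sin^2 (x/2)] would make the sine vanish at
    [|x| / 2], which lies strictly between 0 and [pi]. *)
Lemma expi_neq1 x : 0 < `|x| < 2 * pi -> expi x != 1.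
Proof.
move=> /andP[x0 xpi]; apply/eqP => -[cx _].
have /gt_eqF/eqP[] : 0 < sin (`|x| / 2).
  by apply: sin_gt0_pi; rewrite divr_gt0 //= ltr_pdivrMr // mulrC.
have : cos `|x| = 1 by case: ger0P => _; rewrite ?cosN.
rewrite {1}(splitr `|x|) -mulr2n cos_mulr2n cos2sin2 => /eqP.
have -> : ((1 - sin (`|x| / 2) ^+ 2) *+ 2 - 1 == 1) = (sin (`|x| / 2) ^+ 2 == 0).
  by apply/eqP/eqP; lra.
by rewrite sqrf_eq0 => /eqP.
Qed.

Lemma norm_sin_le x : `|sin x| <= `|x|.
Proof.
have pos (y : R) : 0 <= y -> `|sin y| <= y.
  move=> y0; have [|c _] := @MVT_segment _ sin cos 0 y y0.
    by apply: continuous_subspaceT => z; apply: continuous_sin.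
  rewrite sin0 !subr0 => ->; rewrite normrM (ger0_norm y0) ler_piMl //.
  by rewrite ler_norml cos_geN1 cos_le1.
by case: (ger0P x) => x0; rewrite ?pos // -normrN -sinN pos // oppr_ge0 ltW.
Qed.

(** The chord has length [2 |sin (x/2)|], and [|sin y| <= |y|]. *)
Lemma norm_expi_sub1_le x : `|expi x - 1| <= (`|x|)%:C%C.
Proof.
rewrite normc_def lecR /= -(ler_pXn2r (n := 2)) ?nnegrE ?sqrtr_ge0 //.
rewrite sqr_sqrtr ?addr_ge0 ?sqr_ge0 // subr0.
have -> : (cos x - 1) ^+ 2 + sin x ^+ 2 = (2 * sin (x / 2)) ^+ 2.
  have cx : cos x = 1 - 2 * sin (x / 2) ^+ 2.
    by rewrite {1}(splitr x) -mulr2n cos_mulr2n cos2sin2; lra.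
  by have := cos2Dsin2 x; rewrite cx => ?; nra.
rewrite -[leLHS]real_normK ?num_real // ler_pXn2r ?nnegrE //.
rewrite normrM ger0_norm //; have := norm_sin_le (x / 2).
by rewrite normrM [X in _ <= _ * X]ger0_norm ?invr_ge0 //; lra.
Qed.

End UnitCircle.

(** * Finite Fourier inversion in two variables *)

Section FourierInversion.
Variable R : realType.

Let wave (l k : nat) (n : int) : R[i] := expi (- (2 * pi * k%:R * n%:~R / l%:R)).

(** The summand is the [k]-th power of [expi x], an [l]-th root of unity that depends only on the
    residue of [n]. Distinct residues differ by less than [l], so the ratio is not 1 and the
    geometric sum vanishes. *)
Lemma wave_orthogonal (l n : nat) (n' : 'I_l) :
  \sum_(k < l) wave l k n * (wave l k n')^*%C =
  l%:R * (n' == (n %% l)%N :> nat)%:R.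
Proof.
have l0 : (0 < l)%N by case: (l) n' => [[]|].
have lR0 : l%:R != 0 :> R by rewrite pnatr_eq0 -lt0n.
pose x : R := - (2 * pi * ((n %% l)%N%:R - n'%:R) / l%:R).
have waveE (k : nat) : wave l k n * (wave l k n')^*%C = expi x ^+ k.
  rewrite /wave expi_conj -expiD -expi_natmul opprK.
  have -> : - (2 * pi * k%:R * n%:~R / l%:R) + 2 * pi * k%:R * n'%:~R / l%:R
    = k%:R * x - 2 * pi * (k * (n %/ l))%N%:R :> R.
    rewrite {1}(divn_eq n l) /x PoszD PoszM intrD intrM natrM -!pmulrn.
    by field.
  by rewrite expiD -expi_conj expi_2pi_nat /= oppr0 mulr1.
under eq_bigr do rewrite waveE.
have [nn'|nn'] := eqVneq.
  by rewrite mulr1 /x -nn' subrr mulr0 mul0r oppr0 expi0;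
    under eq_bigr do rewrite expr1n; rewrite sumr_const card_ord.
rewrite mulr0; apply/eqP.
have : (expi x - 1) * (\sum_(k < l) expi x ^+ k) == 0.
  rewrite -subrX1 -expi_natmul subr_eq0 /x.
  have -> : l%:R * - (2 * pi * ((n %% l)%N%:R - n'%:R) / l%:R) =
      2 * pi * ((n' : nat)%:Z - (n %% l)%N%:Z)%:~R :> R.
    by rewrite intrB -!pmulrn; field.
  by rewrite expi_2pi_int ?intr_int.
rewrite mulf_eq0 subr_eq0 => /orP[/eqP x1|//].
exfalso; have /negP[] : expi x != 1; last exact/eqP.
apply: expi_neq1.
have rl : (n %% l < l)%N by rewrite ltn_pmod.
have npi : 0 < 2 * pi :> R by rewrite mulr_gt0 // pi_gt0.
rewrite normrN !normrM normfV (ger0_norm (ler0n _ l)) (ger0_norm (ltW (pi_gt0 R))).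
rewrite (ger0_norm (ler0n _ 2)).
have d0 : 0 < `|(n %% l)%N%:R - n'%:R| :> R by rewrite normr_gt0 subr_eq0 eqr_nat eq_sym.
rewrite divr_gt0 ?ltr0n ?mulr_gt0 ?pi_gt0 //=.
rewrite ltr_pdivrMr ?ltr0n // ltr_pM2l //.
have := ltn_ord n'; rewrite -(ltr_nat R); move: rl; rewrite -(ltr_nat R).
have := ler0n R (n %% l)%N; have := ler0n R n'; rewrite ltr_norml; lra.
Qed.

Lemma phi_wave (l1 l2 k1 k2 : nat) (n m : int) :
  phi R l1 l2 k1 k2 n m = wave l1 k1 n * wave l2 k2 m.
Proof. by []. Qed.

#[local] Arguments conjc {R} x : simpl never.

(** After the inner product is expanded and the sums are exchanged, orthogonality in each variable
    leaves the single term at the residues of [n] and [m]. *)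
Lemma fourier_inversion (l1 l2 : nat) (u : int -> int -> R[i]) (n m : nat) :
    (0 < l1)%N -> (0 < l2)%N ->
    (forall n m, u (n + l1%:Z) m = u n m) ->
    (forall n m, u n (m + l2%:Z) = u n m) ->
  \sum_(k1 < l1) \sum_(k2 < l2)
    inner l1 l2 u (phi R l1 l2 k1 k2) * phi R l1 l2 k1 k2 n m = u n m.
Proof.
move=> l10 l20 u1 u2.
have l1R : l1%:R != 0 :> R[i] by rewrite pnatr_eq0 -lt0n.
have l2R : l2%:R != 0 :> R[i] by rewrite pnatr_eq0 -lt0n.
(* Orthogonality sees only residues, so periodicity is first used to move the argument into the box
   of the inner product. *)
have -> : u n m = u (n %% l1)%N (m %% l2)%N.
  have u1' (q r : nat) z : u (q * l1 + r)%N z = u r z.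
    elim: q => [|q <-]; first by rewrite mul0n.
    by rewrite -(u1 (q * l1 + r)%N) -PoszD mulSn -addnA addnC.
  have u2' (q r : nat) z : u z (q * l2 + r)%N = u z r.
    elim: q => [|q <-]; first by rewrite mul0n.
    by rewrite -(u2 z (q * l2 + r)%N) -PoszD mulSn -addnA addnC.
  by rewrite {1}(divn_eq n l1) {1}(divn_eq m l2) u1' u2'.
transitivity ((l1%:R * l2%:R)^-1 * \sum_(n' < l1) \sum_(m' < l2) u n' m' *
    ((\sum_(k1 < l1) wave l1 k1 n * (wave l1 k1 n')^*%C) *
     (\sum_(k2 < l2) wave l2 k2 m * (wave l2 k2 m')^*%C))).
  rewrite /inner mulr_sumr.
  under eq_bigr => k1 _ do under eq_bigr => k2 _ do
    rewrite -mulrA mulr_suml mulr_sumr.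
  under [in LHS]eq_bigr => k1 _ do rewrite exchange_big /=.
  rewrite exchange_big /=; apply: eq_bigr => n' _.
  under eq_bigr => k1 _ do under eq_bigr => k2 _ do
    rewrite mulr_suml mulr_sumr.
  under [in LHS]eq_bigr => k1 _ do rewrite exchange_big /=.
  rewrite exchange_big mulr_sumr /=; apply: eq_bigr => m' _.
  rewrite mulr_suml !mulr_sumr; apply: eq_bigr => k1 _.
  rewrite !mulr_sumr; apply: eq_bigr => k2 _.
  rewrite !phi_wave [in LHS](rmorphM (@conjc R)).
  ring.
under eq_bigr => n' _ do under eq_bigr => m' _ do rewrite !wave_orthogonal.
pose n' := Ordinal (ltn_pmod n l10); pose m' := Ordinal (ltn_pmod m l20).
rewrite (bigD1 n') //= (bigD1 m') //= !big1 ?addr0.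
- by rewrite !eqxx !mulr1 [u _ _ * _]mulrC mulKf ?mulf_neq0.
- move=> i /eqP ni; apply: big1 => j _.
  by case: (i =P _ :> nat) => [e|]; [case: ni; apply/val_inj|rewrite mulr0 mul0r mulr0].
- move=> j /eqP nj.
  by case: (j =P _ :> nat) => [e|]; [case: nj; apply/val_inj|rewrite !mulr0].
Qed.

End FourierInversion.

(** * Periodicity of the quadratic phase *)

Section ThetaPeriodic.
Variable R : realType.

Lemma expi_add_int (a y : R) : y \is a Num.int ->
  expi (- (2 * pi * (a + y))) = expi (- (2 * pi * a)).
Proof.
by move=> yint; rewrite mulrDr opprD expiD -(mulrN _ y) expi_2pi_int
  ?rpredN // mulr1.
Qed.

(** Since [p1 r1 / (s1 q1) = p12 / q12], the integrality hypothesis taken at [(n - n0, m - m0)] says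
    exactly that the phase grows by an integer number of turns when [n] grows by [l]. *)
Lemma theta_periodicl (p1 q1 p2 q2 p12 q12 : int) (n0 m0 l : nat) :
    p1 != 0 -> q1 != 0 -> q2 != 0 -> q12 != 0 ->
    (forall n m : int,
      (l%:R ^+ 2 * p1%:~R / q1%:~R + 2 * p1%:~R * l%:R / q1%:~R * n%:~R
       + p1%:~R * (p12 * q1)%:~R * l%:R / ((q12 * p1)%:~R * q1%:~R) * m%:~R : R)
        \is a Num.int) ->
  forall n m, theta R p1 q1 p2 q2 p12 q12 n0 m0 (n + l%:Z) m =
    theta R p1 q1 p2 q2 p12 q12 n0 m0 n m.
Proof.
move=> p1n0 q1n0 q2n0 q12n0 per n m; have := per (n - n0%:Z) (m - m0%:Z).
move=> /expi_add_int {}per; rewrite /theta -[RHS]per; congr (expi (- (_ * _))).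
rewrite intrD !intrB !intrM -!pmulrn; field.
by rewrite !intr_eq0 q1n0 p1n0 q12n0 q2n0.
Qed.

Lemma theta_periodicr (p1 q1 p2 q2 p12 q12 : int) (n0 m0 l : nat) :
    p2 != 0 -> q2 != 0 -> q1 != 0 -> q12 != 0 ->
    (forall n m : int,
      (l%:R ^+ 2 * p2%:~R / q2%:~R + 2 * p2%:~R * l%:R / q2%:~R * m%:~R
       + p2%:~R * (p12 * q2)%:~R * l%:R / ((q12 * p2)%:~R * q2%:~R) * n%:~R : R)
        \is a Num.int) ->
  forall n m, theta R p1 q1 p2 q2 p12 q12 n0 m0 n (m + l%:Z) =
    theta R p1 q1 p2 q2 p12 q12 n0 m0 n m.
Proof.
move=> p2n0 q2n0 q1n0 q12n0 per n m; have := per (n - n0%:Z) (m - m0%:Z).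
move=> /expi_add_int {}per; rewrite /theta -[RHS]per; congr (expi (- (_ * _))).
rewrite intrD !intrB !intrM -!pmulrn; field.
by rewrite !intr_eq0 q2n0 q1n0 p2n0 q12n0.
Qed.

End ThetaPeriodic.

(** * Uniform bounds for sums over the lattice *)

Section LatticeSums.
Variable R : realType.

(* Telescopes against the bounded function [4 x / (1 + |x|)]. *)
Lemma sum_inv_sqr_le (z M : nat) :
  \sum_(n < M) (1 + (n%:R - z%:R) ^+ 2)^-1 <= 8 :> R.
Proof.
have [n0 n0z] : exists n0 : R, n0 = z%:R by exists z%:R.
rewrite -n0z; pose G (x : R) := 4 * x / (1 + `|x|).
have Gle x : `|G x| <= 4.
  rewrite !normrM normfV [X in _ / X]ger0_norm ?addr_ge0 //.
  rewrite ler_pdivrMr ?ltr_pwDl // [X in X * _]ger0_norm //.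
  by have := normr_ge0 x; lra.
suff step k : (1 + (k%:R - n0) ^+ 2)^-1 <= G (k.+1%:R - n0) - G (k%:R - n0).
  apply: (@le_trans _ _ (G (M%:R - n0) - G (0%:R - n0))).
    elim: M => [|M IH]; first by rewrite big_ord0 subrr.
    by rewrite big_ord_recr /=; have := step M; lra.
  by have := Gle (M%:R - n0); have := Gle (0%:R - n0); rewrite !ler_norml; lra.
rewrite -natr1 addrAC.
(* The difference of two integers avoids the open interval from -1 to 0, so both absolute values in
   the increment of [G] open with the same sign. In each case what remains is a fraction with
   positive denominator and a quadratic numerator of negative discriminant. *)
have [x0|xneg] : 0 <= k%:R - n0 \/ k%:R - n0 <= -1.
  rewrite n0z; have [zk|kz] := leqP z k; first by left; rewrite subr_ge0 ler_nat.
  by right; move: kz; rewrite -(ler_nat R) -natr1; lra.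
  move: (k%:R - n0) x0 => x x0.
  rewrite /G (ger0_norm x0) ger0_norm ?addr_ge0 // -subr_ge0.
  have -> : 4 * (x + 1) / (1 + (x + 1)) - 4 * x / (1 + x) - (1 + x ^+ 2)^-1 =
    (3 * x ^+ 2 - 3 * x + 2) / ((1 + (x + 1)) * (1 + x) * (1 + x ^+ 2)).
    by field; rewrite !gt_eqF //; nra.
  by rewrite divr_ge0 ?mulr_ge0 //; nra.
move: (k%:R - n0) xneg => x xn.
rewrite /G (@ler0_norm _ x) ?(@ler0_norm _ (x + 1)); [|lra..].
rewrite -subr_ge0.
have -> : 4 * (x + 1) / (1 - (x + 1)) - 4 * x / (1 - x) - (1 + x ^+ 2)^-1 =
  (3 * x ^+ 2 + x + 4) / (- x * (1 - x) * (1 + x ^+ 2)).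
  field; have x2 : 0 < 1 + x ^+ 2 by nra.
  have [x0 x1] : x < 0 /\ 0 < 1 - x by lra.
  have x3 : 0 < 1 - (x + 1) by lra.
  by rewrite (gt_eqF x2) (lt_eqF x0) (gt_eqF x1) (gt_eqF x3).
have [x2 xx] : 0 <= 1 + x ^+ 2 /\ 0 <= 3 * x ^+ 2 + x + 4 by split; nra.
by apply: divr_ge0 => //; apply: mulr_ge0 => //; apply: mulr_ge0; lra.
Qed.

Lemma bound_seq_pairs (s : seq (nat * nat)) :
  exists M, forall i, i \in s -> (i.1 < M)%N && (i.2 < M)%N.
Proof.
exists (\max_(i <- s) maxn i.1 i.2).+1 => i si.
have := @leq_bigmax_seq _ s xpredT (fun i => maxn i.1 i.2) i si isT.
by rewrite geq_max !ltnS.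
Qed.

(** The terms are nonnegative, so the finite set may be enlarged to a square box, over which the sum
    factors. *)
Lemma sum_fset_le_box (f g : nat -> R) (A : {fset nat * nat}) b c :
    (forall n, 0 <= f n) -> (forall n, 0 <= g n) ->
    (forall M, \sum_(n < M) f n <= b) -> (forall M, \sum_(n < M) g n <= c) ->
  \sum_(i : A) f (val i).1 * g (val i).2 <= b * c.
Proof.
move=> f0 g0 fb gc; have [M AM] := bound_seq_pairs (enum_fset A).
rewrite -(big_seq_fsetE _ _ xpredT (fun i => f i.1 * g i.2)).
pose S := [seq (n, m) | n <- iota 0 M, m <- iota 0 M].
have uS : uniq S by apply: allpairs_uniq; rewrite ?iota_uniq // => -[? ?] [].
have perm : perm_eq (enum_fset A) [seq i <- S | i \in A].
  apply: uniq_perm; rewrite ?fset_uniq ?filter_uniq // => i.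
  rewrite mem_filter; case: (boolP (i \in A)) => iA /=; last by apply/negbTE.
  have /andP[i1 i2] := AM _ iA; apply/esym/allpairsP.
  by exists i; rewrite !mem_iota /= !add0n; split => //; case: (i).
rewrite (perm_big _ perm) big_filter /=.
apply: (@le_trans _ _ (\sum_(i <- S) f i.1 * g i.2)).
  by rewrite [leRHS](bigID (mem A)) /= lerDl sumr_ge0 // => i _; rewrite mulr_ge0.
rewrite big_allpairs /=.
under eq_bigr do rewrite -mulr_sumr.
have iotaE h : \sum_(n <- iota 0 M) h n = \sum_(n < M) h n :> R.
  by rewrite -(big_mkord xpredT) /index_iota subn0.
rewrite -mulr_suml !iotaE ler_pM ?sumr_ge0 //.
Qed.

End LatticeSums.

(** * Decay of the profile and position of the nearest levels *)

Section Profile.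
Variable R : realType.
Implicit Types chi : R * R -> R.

(** Expanding the weights gives four squares of a monomial times [chi], each bounded by a Schwartz
    seminorm. The factor [(1 + x^2) (1 + y^2)] provides summability in both variables, while the
    power [N] is what gets traded for powers of [h]. *)
Lemma schwartz_decay chi (N : nat) : schwartz chi ->
  exists2 C : R, 0 <= C & forall x y : R,
    chi (x, y) ^+ 2 * (x ^+ 2) ^+ N * ((1 + x ^+ 2) * (1 + y ^+ 2)) <= C /\
    chi (x, y) ^+ 2 * (y ^+ 2) ^+ N * ((1 + x ^+ 2) * (1 + y ^+ 2)) <= C.
Proof.
move=> /(_ [::])[_ /=] bnd.
pose B a b := sval (cid (bnd a b)).
have BP a b x y : (x ^+ a * y ^+ b * chi (x, y)) ^+ 2 <= B a b ^+ 2.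
  have /= := svalP (cid (bnd a b)) (x, y); rewrite -/(B a b) => h.
  by rewrite -real_normK ?num_real // ler_pXn2r ?nnegrE // (le_trans _ h).
exists (B N 0%N ^+ 2 + B N.+1 0%N ^+ 2 + B N 1%N ^+ 2 + B N.+1 1%N ^+ 2 +
        (B 0%N N ^+ 2 + B 0%N N.+1 ^+ 2 + B 1%N N ^+ 2 + B 1%N N.+1 ^+ 2)).
  by rewrite !addr_ge0 ?sqr_ge0.
move=> x y; split.
  apply: (@le_trans _ _
    (B N 0%N ^+ 2 + B N.+1 0%N ^+ 2 + B N 1%N ^+ 2 + B N.+1 1%N ^+ 2)); last
    by rewrite lerDl !addr_ge0 ?sqr_ge0.
  have := BP N 0%N x y; have := BP N.+1 0%N x y.
  have := BP N 1%N x y; have := BP N.+1 1%N x y.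
  rewrite -exprM mulnC exprM !exprS !expr0; move: (x ^+ N) => z; lra.
apply: (@le_trans _ _ (B 0%N N ^+ 2 + B 0%N N.+1 ^+ 2 + B 1%N N ^+ 2 + B 1%N N.+1 ^+ 2));
  last by rewrite lerDr !addr_ge0 ?sqr_ge0.
have := BP 0%N N x y; have := BP 0%N N.+1 x y.
have := BP 1%N N x y; have := BP 1%N N.+1 x y.
rewrite -exprM mulnC exprM !exprS !expr0; move: (y ^+ N) => z; lra.
Qed.

(** Continuity at a point where [chi] is positive; [c] is half the value there. *)
Lemma schwartz_lower_bound chi : schwartz chi ->
    (forall x, 0 <= chi x) -> (exists x, chi x != 0) ->
  exists a b c e : R, [/\ 0 < c, 0 < e & forall x y,
    `|x - a| < e -> `|y - b| < e -> c <= chi (x, y)].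
Proof.
move=> /(_ [::])[/= diff _] chi0 [[a b] chiab].
have c0 : 0 < chi (a, b) / 2 by rewrite divr_gt0 // lt0r chiab chi0.
have /cvgrPdist_lt/(_ _ c0) := differentiable_continuous (diff (a, b)).
move=> /nbhs_ballP[e /= e0 eP]; exists a, b, (chi (a, b) / 2), e; split => // x y xa yb.
have : ball ((a, b) : R * R) e (x, y).
  by split; rewrite /ball /= -normrN opprB.
by move=> /eP /=; rewrite ltr_norml; lra.
Qed.

(** The integer part of [E / (omega h)] is a natural number because [E > 0], and its level is
    already this close to [E]. *)
Lemma nearest_level (omega h E : R) (n0 : nat) : 0 < omega -> 0 < h -> 0 < E ->
  unique_nearest omega h E n0 -> `|level omega h n0%:Z - E| <= omega * h.
Proof.
move=> o0 h0 E0 un; have oh0 : 0 < omega * h by rewrite mulr_gt0.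
pose e := E / (omega * h); pose n := Num.truncn e.
have nE : `|level omega h n%:Z - E| <= omega * h.
  rewrite (_ : _ - E = omega * h * (n%:R + 2^-1 - e)); last first.
    by rewrite /level /e -pmulrn; field; rewrite !gt_eqF.
  rewrite normrM gtr0_norm // ler_piMr ?(ltW oh0) //.
  have : 0 <= e by rewrite divr_ge0 ?ltW.
  by move=> /truncn_itv; rewrite -/n -natr1 ler_norml; lra.
by have [<-//|nn0] := eqVneq n n0; apply: le_trans (ltW (un _ nn0)) nE.
Qed.

Lemma level_sub (omega h : R) (n m : int) :
  level omega h n - level omega h m = omega * h * (n%:~R - m%:~R).
Proof. by rewrite /level; ring. Qed.

(** The rescaled lattice has mesh [eps = omega h^(1 - delta)], which tends to 0, so it comes close
    to any given [a]. The index is the integer part of [n0 + a / eps]. *)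
Lemma lattice_point (omega E delta a e : R) : 0 < omega -> 0 < E ->
    0 < delta < 1 -> 0 < e ->
  \forall h \near 0^'+, forall n0, unique_nearest omega h E n0 ->
    exists n : nat,
      `|(level omega h n%:Z - level omega h n0%:Z) / h `^ delta - a| < e.
Proof.
move=> o0 E0 /andP[d0 d1] e0.
have d1' : 0 < 1 - delta by lra.
have E3 : 0 < E / (3 * omega) by rewrite divr_gt0 // mulr_gt0.
have Ea : 0 < E / (2 * (1 + `|a|)) by rewrite divr_gt0 // mulr_gt0 // ltr_pwDl.
have eo : 0 < e / omega by rewrite divr_gt0.
near=> h => n0 un.
have h0 : 0 < h by near: h; exact: nbhs_right_gt.
have hd0 : 0 < h `^ delta by rewrite powR_gt0.
have oh0 : 0 < omega * h by rewrite mulr_gt0.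
pose eps := omega * h / h `^ delta.
have eps0 : 0 < eps by rewrite divr_gt0.
have epsE : eps = omega * h `^ (1 - delta).
  by rewrite powRB ?powRr1 ?ltW // ?mulrA // gt_eqF ?implybT.
have epse : eps < e.
  rewrite epsE mulrC -ltr_pdivlMr //.
  have : `|0 - h `^ (1 - delta)| < e / omega.
    by near: h; exact: (cvgrPdist_lt _ _).1 (powR_cvg0 d1') _ eo.
  by rewrite sub0r normrN gtr0_norm // powR_gt0.
(* A negative [a] could push the index below 0. These two bounds prevent it: [omega h n0] exceeds
   [E / 2], while the shift [a h^delta] is smaller than [E / 2] in absolute value. *)
have hE3 : 3 * omega * h < E.
  rewrite mulrC -ltr_pdivlMr ?mulr_gt0 //.
have hda : h `^ delta * (1 + `|a|) < E / 2.
  rewrite -ltr_pdivlMr ?ltr_pwDl // -mulrA -invfM.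
  have : `|0 - h `^ delta| < E / (2 * (1 + `|a|)).
    by near: h; exact: (cvgrPdist_lt _ _).1 (powR_cvg0 d0) _ Ea.
  by rewrite sub0r normrN gtr0_norm.
have n0E : - (omega * h) <= omega * h * (n0%:R + 2^-1) - E.
  by have := nearest_level o0 h0 E0 un; rewrite /level -pmulrn ler_norml => /andP[].
have n0pos : 0 <= n0%:R + a / eps.
  rewrite -(pmulr_rge0 _ oh0) mulrDr /eps.
  have -> : omega * h * (a / (omega * h / h `^ delta)) = a * h `^ delta.
    by field; rewrite !gt_eqF.
  have := ler_norm (- a); rewrite normrN => na.
  have : - `|a| * h `^ delta <= a * h `^ delta by rewrite ler_pM2r //; lra.
  lra.
exists (Num.truncn (n0%:R + a / eps)).
have := truncn_itv n0pos; set n := Num.truncn _; rewrite -natr1 => /andP[n1 n2].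
rewrite level_sub -!pmulrn mulrAC -/eps.
have -> : eps * (n%:R - n0%:R) - a = eps * (n%:R - (n0%:R + a / eps)).
  by field; rewrite gt_eqF.
rewrite normrM gtr0_norm // (le_lt_trans _ epse) // ler_piMr ?(ltW eps0) //.
by rewrite ler_norml; lra.
Unshelve. all: by end_near.
Qed.

(** With [u = (d h^(1 - delta))^2] one has [u <= 1 + u^N]. Also [u] is the square of the rescaled
    variable times [h^(2 (delta' - delta)) / omega^2], so the [N]-th power gains at least [h^4] by
    the choice of [N]. *)
Lemma sqr_le_scaled_power (h omega delta delta' d : R) (N : nat) :
    0 < h <= 1 -> 0 < omega -> 0 <= delta -> delta' < 1 -> (0 < N)%N ->
    2 <= N%:R * (delta' - delta) ->
  d ^+ 2 <= h `^ (2 * delta - 2) *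
    (1 + ((omega * h * d / h `^ delta') ^+ 2) ^+ N * (h ^+ 4 / (omega ^+ 2) ^+ N)).
Proof.
move=> /andP[h0 h1] o0 de0 de1 N0 Nd.
have pw (r : R) : 0 < h `^ r by rewrite powR_gt0.
pose u := (d * h `^ (1 - delta)) ^+ 2.
have -> : d ^+ 2 = h `^ (2 * delta - 2) * u.
  rewrite /u exprMn mulrCA -[h `^ (1 - _) ^+ 2]powR_mulrn ?ltW // -powRrM -powRD.
    rewrite (_ : _ + _ = 0) ?powRr0 ?mulr1 //; lra.
  by rewrite (gt_eqF h0) implybT.
rewrite ler_pM2l //.
apply: (@le_trans _ _ (1 + u ^+ N)).
  have [u1|u1] := leP u 1; first by rewrite ler_wpDr // exprn_ge0 // sqr_ge0.
  by rewrite ler_wpDl // ler_eXnr // ltW.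
rewrite lerD2l.
have -> : u = (omega * h * d / h `^ delta') ^+ 2 *
    (h `^ (delta' - delta) ^+ 2 / omega ^+ 2).
  rewrite /u; have -> : h `^ (1 - delta) = h / h `^ delta' * h `^ (delta' - delta).
    rewrite -[X in _ = X / _ * _]powRr1 ?ltW // -powRB ?(gt_eqF h0) ?implybT //
      -powRD ?(gt_eqF h0) ?implybT //.
    by congr powR; ring.
  by field; rewrite !gt_eqF.
rewrite [leLHS]exprMn; apply: ler_wpM2l; first by rewrite exprn_ge0 ?sqr_ge0.
rewrite [leLHS]exprMn exprVn; apply: ler_wpM2r.
  by rewrite invr_ge0 exprn_ge0 ?sqr_ge0.
rewrite -exprM -(powR_mulrn _ (ltW (pw _))) -powRrM -(powR_mulrn _ (ltW h0)).
apply: ger_powR; first by rewrite h0.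
by rewrite natrM; lra.
Qed.

End Profile.

(** * Mass and second moment of the weights at fixed [h] *)

Section PacketMoments.
Variable R : realType.

Lemma rsum2_eq (u : nat * nat -> R) (l : R) :
  partial_sum u @ totally --> l -> rsum2 u = l.
Proof. by move=> ul; apply: cvg_lim ul; exact: norm_hausdorff. Qed.

Lemma csum2_eq (u : nat * nat -> R[i]) (l : R[i]^o) :
  partial_sum (u : _ -> R[i]^o) @ totally --> l -> csum2 u = l.
Proof. by move=> ul; apply: cvg_lim ul; exact: norm_hausdorff. Qed.

(** As [omega * h] and the power of [h] are at most 1, the rescaled denominator dominates
    [(omega h)^2 (1 + d^2)]. The loss is of order [h^(-2)] per variable; the factor [h^4] of
    [sqr_le_scaled_power] compensates it. *)
Lemma scaled_inv_le (h omega delta d : R) : 0 < h <= 1 -> 0 <= delta ->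
    0 < omega -> omega * h <= 1 ->
  (1 + (omega * h * d / h `^ delta) ^+ 2)^-1 <=
  ((omega * h) ^+ 2)^-1 * (1 + d ^+ 2)^-1.
Proof.
move=> /andP[h0 h1] d0 o0 oh1; have oh0 : 0 < omega * h by rewrite mulr_gt0.
have sq : 0 < 1 + d ^+ 2 by rewrite ltr_pwDl ?sqr_ge0.
rewrite -invfM lef_pV2 ?posrE ?mulr_gt0 ?exprn_gt0 //; last first.
  by rewrite ltr_pwDl ?sqr_ge0.
rewrite mulrDr mulr1 lerD //; first by rewrite expr_le1 // ltW.
rewrite -exprMn [leRHS]exprMn ler_peMr ?sqr_ge0 //.
have hd : h `^ delta <= 1.
  by rewrite -[leRHS](powRr0 h); apply: ger_powR; rewrite ?h0.
by rewrite exprVn invr_ge1 ?unitfE ?expf_neq0 ?gt_eqF ?powR_gt0 //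
  ?exprn_gt0 ?powR_gt0 // expr_le1 // powR_ge0.
Qed.

Definition packet_weight (omega1 omega2 delta1' delta2' : R) (chi : R * R -> R)
    (h : R) (n0 m0 : nat) (nm : nat * nat) : R :=
  `|coeff omega1 omega2 delta1' delta2' chi h n0 m0 nm.1%:Z nm.2%:Z| ^+ 2.

Section FixedParameter.
Variables (omega1 omega2 delta1 delta2 delta1' delta2' : R) (chi : R * R -> R).
Variables (N : nat) (h C C0 c : R) (n0 m0 n1 m1 : nat).
Hypotheses (ho1 : 0 < omega1) (ho2 : 0 < omega2) (hh : 0 < h <= 1)
  (ho1h : omega1 * h <= 1) (ho2h : omega2 * h <= 1)
  (hd1 : 0 <= delta1) (hd2 : 0 <= delta2)
  (hd1' : 0 <= delta1' < 1) (hd2' : 0 <= delta2' < 1) (N0 : (0 < N)%N)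
  (N1 : 2 <= N%:R * (delta1' - delta1)) (N2 : 2 <= N%:R * (delta2' - delta2))
  (C_ge0 : 0 <= C) (C0_ge0 : 0 <= C0) (c_gt0 : 0 < c)
  (decay0 : forall x y : R,
    chi (x, y) ^+ 2 * ((1 + x ^+ 2) * (1 + y ^+ 2)) <= C0)
  (decayN : forall x y : R,
    chi (x, y) ^+ 2 * (x ^+ 2) ^+ N * ((1 + x ^+ 2) * (1 + y ^+ 2)) <= C /\
    chi (x, y) ^+ 2 * (y ^+ 2) ^+ N * ((1 + x ^+ 2) * (1 + y ^+ 2)) <= C)
  (chi_c : c <= profile omega1 omega2 delta1' delta2' chi h n0 m0 n1%:Z m1%:Z).

Let X (n : nat) : R := omega1 * h * (n%:R - n0%:R) / h `^ delta1'.
Let Y (m : nat) : R := omega2 * h * (m%:R - m0%:R) / h `^ delta2'.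
Let D1 (n : nat) : R := (1 + (n%:R - n0%:R) ^+ 2)^-1.
Let D2 (m : nat) : R := (1 + (m%:R - m0%:R) ^+ 2)^-1.
Let w := packet_weight omega1 omega2 delta1' delta2' chi h n0 m0.
Let g (nm : nat * nat) : R := chi (X nm.1, Y nm.2) ^+ 2.
Let K : R := ((omega1 * h) ^+ 2)^-1 * ((omega2 * h) ^+ 2)^-1.

Let h0 : 0 < h. Proof. by case/andP: hh. Qed.
Let o1h : 0 < omega1 * h. Proof. exact: mulr_gt0. Qed.
Let o2h : 0 < omega2 * h. Proof. exact: mulr_gt0. Qed.
Let K0 : 0 <= K. Proof. by rewrite mulr_ge0 ?invr_ge0 ?sqr_ge0. Qed.
Let D10 n : 0 <= D1 n. Proof. by rewrite invr_ge0 addr_ge0 ?sqr_ge0. Qed.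
Let D20 n : 0 <= D2 n. Proof. by rewrite invr_ge0 addr_ge0 ?sqr_ge0. Qed.
Let g0 nm : 0 <= g nm. Proof. exact: sqr_ge0. Qed.

(** Passage from decay in the rescaled variables to the summable weights [D1] and [D2], at the price
    of [K], which is of order [h^(-4)]. *)
Let decay_lattice (B z : R) n m : 0 <= B ->
  z * ((1 + X n ^+ 2) * (1 + Y m ^+ 2)) <= B -> z <= B * K * (D1 n * D2 m).
Proof.
move=> B0; have pX : 0 < 1 + X n ^+ 2 by rewrite ltr_pwDl ?sqr_ge0.
have pY : 0 < 1 + Y m ^+ 2 by rewrite ltr_pwDl ?sqr_ge0.
rewrite -ler_pdivlMr ?mulr_gt0 // => /le_trans; apply.
rewrite -mulrA ler_wpM2l // invfM /K mulrACA.
rewrite ler_pM ?invr_ge0 ?(ltW pX) ?(ltW pY) //.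
  by apply: scaled_inv_le => //; case/andP: hd1'.
by apply: scaled_inv_le => //; case/andP: hd2'.
Qed.

Let sumDD (A : {fset nat * nat}) (B : R) : 0 <= B ->
  \sum_(i : A) B * (D1 (val i).1 * D2 (val i).2) <= 64 * B.
Proof.
move=> B0; rewrite -mulr_sumr mulrC ler_wpM2r //.
rewrite (_ : 64 = 8 * 8); last by rewrite -natrM.
by apply: sum_fset_le_box => // M; apply: sum_inv_sqr_le.
Qed.

Let profileE n m :
  profile omega1 omega2 delta1' delta2' chi h n0 m0 n%:Z m%:Z = chi (X n, Y m).
Proof. by rewrite /profile !level_sub -!pmulrn. Qed.

Let P := rsum2 g.

(** The upper bound from decay, though it blows up with [h], makes the sum converge; the lower bound
    comes from the one term at [(n1, m1)] and is free of [h]. *)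
Let P_lb : c ^+ 2 <= P /\ forall A, partial_sum g A <= P.
Proof.
have bnd A : partial_sum g A <= 64 * (C0 * K).
  apply: le_trans (sumDD A (mulr_ge0 C0_ge0 K0)).
  by apply: ler_sum => i _; apply: decay_lattice => //; apply: decay0.
have [l gl] := nonneg_partial_sum_cvg g0 bnd.
have lb A : partial_sum g A <= P.
  by rewrite /P (rsum2_eq gl); apply: nonneg_partial_sum_le_lim gl.
split=> //; apply: le_trans (lb [fset (n1, m1)]%fset).
rewrite /partial_sum -(big_seq_fsetE _ _ xpredT) big_seq_fset1 /g /=.
have p0 := lt_le_trans c_gt0 chi_c.
by rewrite -profileE ler_pXn2r ?nnegrE ?(ltW p0) ?(ltW c_gt0).
Qed.

Let P_gt0 : 0 < P.
Proof. by apply: lt_le_trans P_lb.1; rewrite exprn_gt0. Qed.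

Let wE nm : w nm = g nm / P.
Proof.
rewrite /w /packet_weight /coeff /normalization profileE.
rewrite (_ : rsum2 _ = P); last first.
  by congr rsum2; apply/funext => i; rewrite profileE real_normK ?num_real.
rewrite normrM exprMn !real_normK ?num_real // exprVn sqr_sqrtr ?ltW //.
by rewrite mulrC.
Qed.

Lemma packet_mass A : partial_sum w A <= 1.
Proof.
rewrite /partial_sum; under eq_bigr do rewrite wE.
by rewrite -mulr_suml ler_pdivrMr // mul1r; apply: P_lb.2.
Qed.

Let const_ge0 (o : R) :
  0 <= C / c ^+ 2 / (omega1 ^+ 2 * omega2 ^+ 2 * (o ^+ 2) ^+ N).
Proof.
apply: divr_ge0; first by rewrite divr_ge0 ?sqr_ge0.
apply: mulr_ge0; first by rewrite mulr_ge0 ?sqr_ge0.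
by apply: exprn_ge0; apply: sqr_ge0.
Qed.

(** Common to both coordinates, with [z] the [N]-th power of the squared rescaled variable. In the
    bound on [d^2] the term 1 is paid by the total mass, and the term in [z] by the decay of
    [chi]. *)
Let moment (d z : nat * nat -> R) (omega delta : R)
    (A : {fset nat * nat}) : 0 < omega -> (forall nm, 0 <= z nm) ->
    (forall nm, g nm * z nm <= C * K * (D1 nm.1 * D2 nm.2)) ->
    (forall nm, d nm ^+ 2 <= h `^ (2 * delta - 2) *
       (1 + z nm * (h ^+ 4 / (omega ^+ 2) ^+ N))) ->
  \sum_(i : A) w (val i) * d (val i) ^+ 2 <=
  h `^ (2 * delta - 2) *
    (1 + 64 * (C / c ^+ 2 / (omega1 ^+ 2 * omega2 ^+ 2 * (omega ^+ 2) ^+ N))).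
Proof.
move=> o0 z0 gz dz; set k := C / _ / _.
have k0 : 0 <= k := const_ge0 omega.
have op : 0 < (omega ^+ 2) ^+ N by rewrite !exprn_gt0.
apply: (@le_trans _ _ (h `^ (2 * delta - 2) *
   \sum_(i : A) (w (val i) + k * (D1 (val i).1 * D2 (val i).2)))); last first.
  rewrite ler_wpM2l ?powR_ge0 // big_split /= lerD //; first exact: packet_mass.
  exact: sumDD.
rewrite mulr_sumr; apply: ler_sum => i _; set nm := val i.
have w0 : 0 <= w nm by rewrite sqr_ge0.
apply: (le_trans (ler_wpM2l w0 (dz nm))).
rewrite mulrCA ler_wpM2l ?powR_ge0 // mulrDr mulr1 lerD2l [leLHS]mulrA.
(* Dividing by [P >= c^2] turns decay of [g] into decay of the weight. The factor [h^4] then cancels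
   [K] exactly, so the constant [k] does not depend on [h]. *)
apply: (@le_trans _ _ (C * K * (D1 nm.1 * D2 nm.2) / c ^+ 2 *
   (h ^+ 4 / (omega ^+ 2) ^+ N))).
  apply: ler_wpM2r; first by rewrite divr_ge0 ?(ltW op) // exprn_ge0 ?(ltW h0).
  rewrite wE mulrAC.
  apply: ler_pM => //; first by rewrite mulr_ge0.
    by rewrite invr_ge0 ltW.
  by rewrite lef_pV2 ?posrE ?exprn_gt0 // P_lb.1.
rewrite le_eqVlt; apply/orP; left; apply/eqP; rewrite /k /K; field.
by rewrite !gt_eqF.
Qed.

(** One moment estimate per coordinate; since [h <= 1], the smaller of the two exponents gives the
    larger power and dominates both. *)
Lemma packet_second_moment A :
  partial_sum (fun nm => w nm * ((nm.1%:R - n0%:R) ^+ 2 + (nm.2%:R - m0%:R) ^+ 2)) A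
  <= (2 + 64 * (C / c ^+ 2 / (omega1 ^+ 2 * omega2 ^+ 2)) *
       (((omega1 ^+ 2) ^+ N)^-1 + ((omega2 ^+ 2) ^+ N)^-1)) *
     h `^ (2 * Num.min delta1 delta2 - 2).
Proof.
have pow_min d : Num.min delta1 delta2 <= d ->
    h `^ (2 * d - 2) <= h `^ (2 * Num.min delta1 delta2 - 2).
  by move=> md; apply: ger_powR => //; lra.
rewrite /partial_sum; under eq_bigr do rewrite mulrDr.
rewrite big_split /=.
have mom1 : \sum_(i : A) w (val i) * ((val i).1%:R - n0%:R) ^+ 2 <= _ :=
  @moment (fun nm => nm.1%:R - n0%:R) (fun nm => (X nm.1 ^+ 2) ^+ N)
     omega1 delta1 A ho1 (fun nm => exprn_ge0 N (sqr_ge0 _))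
     (fun nm => decay_lattice C_ge0 (decayN (X nm.1) (Y nm.2)).1)
     (fun nm => sqr_le_scaled_power _ hh ho1 hd1 (andP hd1').2 N0 N1).
have mom2 : \sum_(i : A) w (val i) * ((val i).2%:R - m0%:R) ^+ 2 <= _ :=
  @moment (fun nm => nm.2%:R - m0%:R) (fun nm => (Y nm.2 ^+ 2) ^+ N)
     omega2 delta2 A ho2 (fun nm => exprn_ge0 N (sqr_ge0 _))
     (fun nm => decay_lattice C_ge0 (decayN (X nm.1) (Y nm.2)).2)
     (fun nm => sqr_le_scaled_power _ hh ho2 hd2 (andP hd2').2 N0 N2).
apply: (le_trans (lerD mom1 mom2)).
set k1 := 1 + _; set k2 := 1 + _.
have k0 (o : R) :
    0 <= 1 + 64 * (C / c ^+ 2 / (omega1 ^+ 2 * omega2 ^+ 2 * (o ^+ 2) ^+ N)).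
  by rewrite addr_ge0 // mulr_ge0.
apply: (@le_trans _ _ (h `^ (2 * Num.min delta1 delta2 - 2) * k1 +
   h `^ (2 * Num.min delta1 delta2 - 2) * k2)).
  by rewrite lerD // ler_wpM2r ?k0 // pow_min // ge_min lexx ?orbT.
rewrite -mulrDr mulrC /k1 /k2 !invfM !mulrA !mulrDr ler_wpM2r ?powR_ge0 //; lra.
Qed.

End FixedParameter.
End PacketMoments.

(** * Uniformity for small [h] and linearity of the sums *)

Section Packets.
Variable R : realType.

Lemma continuous_horner2 (G : {poly {poly R}}) (z : R * R) :
  (fun z : R * R => G.[z.1, z.2]) @ z --> G.[z.1, z.2].
Proof.
elim/poly_ind: G => [|G c IH].
  by under eq_fun do rewrite !horner0; rewrite !horner0; apply: cvg_cst.
have hE (y : R * R) : (G * 'X + c%:P).[y.1, y.2] = G.[y.1, y.2] * y.1 + c.[y.2].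
  by rewrite hornerMXaddC hornerD hornerM hornerC.
under eq_fun do rewrite hE; rewrite hE.
apply: cvgD; first by apply: cvgM => //; exact: cvg_fst.
apply: (@continuous_comp _ _ _ snd (horner c) z); first exact: cvg_snd.
exact: continuous_horner.
Qed.

Lemma horner2_neq0_nearby (G : {poly {poly R}}) (E1 E2 : R) :
    G.[E1, E2] != 0 ->
  exists2 e : R, 0 < e & forall x y,
    `|x - E1| < e -> `|y - E2| < e -> G.[x, y] != 0.
Proof.
move=> G0; have n0 : 0 < `|G.[E1, E2]| by rewrite normr_gt0.
have /cvgrPdist_lt/(_ _ n0) := @continuous_horner2 G (E1, E2).
move=> /nbhs_ballP[e /= e0 eP]; exists e => // x y xE yE.
have : ball ((E1, E2) : R * R) e (x, y) by split; rewrite /ball /= -normrN opprB.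
by move=> /eP /=; apply: contraTneq => ->; rewrite subr0 ltxx.
Qed.

(** The nearest levels converge to [(E1, E2)], so nonvanishing persists there by continuity. Applied
    to the first derivatives, this makes the semi-classical periods well defined and nonzero. *)
Lemma horner2_level_neq0 (G : {poly {poly R}}) (omega1 omega2 E1 E2 : R) :
    0 < omega1 -> 0 < omega2 -> 0 < E1 -> 0 < E2 -> G.[E1, E2] != 0 ->
  \forall h \near 0^'+, forall n0 m0,
    unique_nearest omega1 h E1 n0 -> unique_nearest omega2 h E2 m0 ->
    G.[level omega1 h n0%:Z, level omega2 h m0%:Z] != 0.
Proof.
move=> o1 o2 E10 E20 /horner2_neq0_nearby[e e0 eP].
have e1 : 0 < e / omega1 by rewrite divr_gt0.
have e2 : 0 < e / omega2 by rewrite divr_gt0.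
near=> h => n0 m0 un um.
have h0 : 0 < h by near: h; exact: nbhs_right_gt.
have he1 : h < e / omega1 by near: h; exact: nbhs_right_lt.
have he2 : h < e / omega2 by near: h; exact: nbhs_right_lt.
apply: eP.
  apply: le_lt_trans (nearest_level o1 h0 E10 un) _.
  by rewrite mulrC -ltr_pdivlMr.
apply: le_lt_trans (nearest_level o2 h0 E20 um) _.
by rewrite mulrC -ltr_pdivlMr.
Unshelve. all: by end_near.
Qed.

(** All constants of the fixed-parameter estimates are chosen before [h]: the exponent [N] from the
    gaps, [C] and [C0] from the decay of [chi], and [c] from a ball on which [chi] is bounded
    below. *)
Lemma packet_moments (omega1 omega2 E1 E2 delta1 delta2 delta1' delta2' : R)
    (chi : R * R -> R) :
    0 < omega1 -> 0 < omega2 -> 0 < E1 -> 0 < E2 ->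
    0 < delta1 < delta1' -> delta1' < 1 -> 0 < delta2 < delta2' -> delta2' < 1 ->
    schwartz chi -> (forall x, 0 <= chi x) -> (exists x, chi x != 0) ->
  exists C : R, \forall h \near 0^'+, forall n0 m0,
    unique_nearest omega1 h E1 n0 -> unique_nearest omega2 h E2 m0 ->
    let w := packet_weight omega1 omega2 delta1' delta2' chi h n0 m0 in
    forall A, partial_sum w A <= 1 /\
      partial_sum (fun nm => w nm *
        ((nm.1%:R - n0%:R) ^+ 2 + (nm.2%:R - m0%:R) ^+ 2)) A <=
      C * h `^ (2 * Num.min delta1 delta2 - 2).
Proof.
move=> o1 o2 E10 E20 /andP[d1 d11] d1' /andP[d2 d22] d2' chiS chi0 chin0.
pose gam := Num.min (delta1' - delta1) (delta2' - delta2).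
have gam0 : 0 < gam by rewrite lt_min !subr_gt0 d11.
(* Large enough for both gaps at once to gain the required [h^4]. *)
pose N := (Num.truncn (2 / gam)).+1.
have Ngam : 2 <= N%:R * gam.
  rewrite -ler_pdivrMr // ltW //.
  by have /truncn_itv/andP[] : 0 <= 2 / gam by rewrite divr_ge0 ?ltW.
have N1 : 2 <= N%:R * (delta1' - delta1).
  by rewrite (le_trans Ngam) // ler_wpM2l // /gam ge_min lexx.
have N2 : 2 <= N%:R * (delta2' - delta2).
  by rewrite (le_trans Ngam) // ler_wpM2l // /gam ge_min lexx orbT.
have [C C_ge0 decayN] := schwartz_decay N chiS.
have [C0 C0_ge0 decay0] := schwartz_decay 0 chiS.
have [a [b [c [e [c0 e0 lb]]]]] := schwartz_lower_bound chiS chi0 chin0.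
have d1'01 : 0 < delta1' < 1 by rewrite d1' andbT; lra.
have d2'01 : 0 < delta2' < 1 by rewrite d2' andbT; lra.
exists (2 + 64 * (C / c ^+ 2 / (omega1 ^+ 2 * omega2 ^+ 2)) *
  (((omega1 ^+ 2) ^+ N)^-1 + ((omega2 ^+ 2) ^+ N)^-1)).
near=> h => n0 m0 un um /= A.
have h0 : 0 < h by near: h; exact: nbhs_right_gt.
have hle1 : h <= 1 by near: h; apply: nbhs_right_le.
have oh1 : omega1 * h <= 1.
  rewrite mulrC -ler_pdivlMr // div1r.
  by near: h; apply: nbhs_right_le; rewrite invr_gt0.
have oh2 : omega2 * h <= 1.
  rewrite mulrC -ler_pdivlMr // div1r.
  by near: h; apply: nbhs_right_le; rewrite invr_gt0.
(* A lattice point whose rescaled position falls where [chi >= c]; it keeps the normalization under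
   control. *)
have [n1 n1a] : exists n : nat, `|(level omega1 h n%:Z - level omega1 h n0%:Z)
    / h `^ delta1' - a| < e.
  by move: n0 un; near: h; exact: (lattice_point a o1 E10 d1'01 e0).
have [m1 m1b] : exists m : nat, `|(level omega2 h m%:Z - level omega2 h m0%:Z)
    / h `^ delta2' - b| < e.
  by move: m0 um; near: h; exact: (lattice_point b o2 E20 d2'01 e0).
have hh : 0 < h <= 1 by rewrite h0.
have d1'0 : 0 <= delta1' < 1 by rewrite d1' andbT; lra.
have d2'0 : 0 <= delta2' < 1 by rewrite d2' andbT; lra.
have chic : c <= profile omega1 omega2 delta1' delta2' chi h n0 m0 n1%:Z m1%:Z.
  exact: lb.
have dec0 x y : chi (x, y) ^+ 2 * ((1 + x ^+ 2) * (1 + y ^+ 2)) <= C0.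
  by have [] := decay0 x y; rewrite expr0 mulr1.
split.
  exact: (packet_mass o1 o2 hh oh1 oh2 d1'0 d2'0 C0_ge0 c0 dec0 chic).
exact: (packet_second_moment o1 o2 hh oh1 oh2 (ltW d1) (ltW d2) d1'0 d2'0
  (isT : (0 < N)%N) N1 N2 C_ge0 C0_ge0 c0 dec0 decayN chic A).
Unshelve. all: by end_near.
Qed.

(** Real and imaginary parts are dominated by [w], because sines and cosines are at most 1 in
    absolute value. *)
Lemma packet_sum_cvg (w x : nat * nat -> R) : (forall i, 0 <= w i) ->
    (forall A, partial_sum w A <= 1) ->
  exists l : R[i]^o,
    partial_sum (fun i => (w i)%:C%C * expi (x i) : R[i]^o) @ totally --> l.
Proof.
move=> w0 w1.
apply: (@dominated_complex_partial_sum_cvg _ _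
  (fun i => (w i)%:C%C * expi (x i)) w 1) => // i; rewrite /= mul0r.
  by rewrite subr0 normrM (ger0_norm (w0 i)) ler_piMr // ler_norml cos_geN1 cos_le1.
by rewrite addr0 normrM (ger0_norm (w0 i)) ler_piMr // ler_norml sin_geN1 sin_le1.
Qed.

Section PartialSumLinear.
Variables (I : choiceType) (K : numFieldType) (V : normedModType K).
Implicit Types f g : I -> V.

Lemma partial_sum_cvgD f g (l m : V) : partial_sum f @ totally --> l ->
  partial_sum g @ totally --> m ->
  partial_sum (fun i => f i + g i) @ totally --> l + m.
Proof.
move=> fl gm; rewrite (_ : partial_sum _ = partial_sum f + partial_sum g).
  exact: cvgD fl gm.
by apply/funext => A; exact: big_split.
Qed.

Lemma partial_sum_cvgZ (k : K) f (l : V) : partial_sum f @ totally --> l ->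
  partial_sum (fun i => k *: f i) @ totally --> k *: l.
Proof.
move=> fl; rewrite (_ : partial_sum _ = k \*: partial_sum f).
  exact: cvgZl_tmp fl.
by apply/funext => A; rewrite /partial_sum -scaler_sumr.
Qed.

Lemma partial_sum_cvg_sum n (f : 'I_n -> I -> V) (l : 'I_n -> V) :
  (forall k, partial_sum (f k) @ totally --> l k) ->
  partial_sum (fun i => \sum_(k < n) f k i) @ totally --> \sum_(k < n) l k.
Proof.
elim: n => [|n IH] in f l * => fl.
  rewrite big_ord0; under eq_fun do rewrite big_ord0.
  rewrite (_ : partial_sum _ = fun=> 0); first exact: cvg_cst.
  by apply/funext => A; exact: big1.
rewrite big_ord_recl; under eq_fun do rewrite big_ord_recl.
by apply: partial_sum_cvgD => //; apply: IH => k; exact: fl.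
Qed.

End PartialSumLinear.

(** Linearity of the limit reduces the estimate to finite partial sums, where the terms can be
    combined one lattice point at a time. *)
Lemma norm_csum2_combination_le (l1 l2 : nat) (u : nat * nat -> R[i])
    (v : 'I_l1 -> 'I_l2 -> nat * nat -> R[i]) (c : 'I_l1 -> 'I_l2 -> R[i])
    (b : R[i]) :
    (exists l : R[i]^o, partial_sum (u : _ -> R[i]^o) @ totally --> l) ->
    (forall k1 k2, exists l : R[i]^o,
      partial_sum (v k1 k2 : _ -> R[i]^o) @ totally --> l) ->
    (forall A : {fset nat * nat}, `|\sum_(i : A) (u (val i) -
      \sum_(k1 < l1) \sum_(k2 < l2) c k1 k2 * v k1 k2 (val i))| <= b) ->
  `|csum2 u - \sum_(k1 < l1) \sum_(k2 < l2) c k1 k2 * csum2 (v k1 k2)| <= b.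
Proof.
move=> [lu ul] vl bnd.
have vsum : partial_sum (fun i => (-1 : R[i]) *: \sum_(k1 < l1) \sum_(k2 < l2)
      c k1 k2 *: (v k1 k2 i : R[i]^o)) @ totally -->
    (-1 : R[i]) *: \sum_(k1 < l1) \sum_(k2 < l2)
      c k1 k2 *: (csum2 (v k1 k2) : R[i]^o).
  apply: partial_sum_cvgZ; apply: partial_sum_cvg_sum => k1.
  apply: partial_sum_cvg_sum => k2; apply: partial_sum_cvgZ.
  by have [l vkl] := vl k1 k2; rewrite (csum2_eq vkl).
have := norm_lim_partial_sum_le (partial_sum_cvgD ul vsum).
rewrite (csum2_eq ul) scaleN1r; apply => A.
apply: le_trans (bnd A); rewrite le_eqVlt; apply/orP; left; apply/eqP.
by congr `|_|; apply: eq_bigr => i _; rewrite scaleN1r.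
Qed.

End Packets.

(** * Splitting the phase at time [t + Tf] and bounding the error *)

Section Revival.
Variable R : realType.

(** Here [T1], [T2] stand for the classical periods and [S1], [S2], [S12] for the revival periods;
    [B] bounds the inverse revival periods and [M] the second moment. The error per lattice point is
    at most [2 pi t |Q|] times the weight, with [|Q| <= 2 B (dn^2 + dm^2)]. *)
Lemma revival_expansion (w : nat * nat -> R) (p1 q1 p2 q2 p12 q12 : int)
    (l1 l2 n0 m0 : nat) (T1 T2 S1 S2 S12 Tf t B M : R) :
    p1 != 0 -> q1 != 0 -> p2 != 0 -> q2 != 0 -> q12 != 0 ->
    (0 < l1)%N -> (0 < l2)%N ->
    (forall n m : int,
      (l1%:R ^+ 2 * p1%:~R / q1%:~R + 2 * p1%:~R * l1%:R / q1%:~R * n%:~R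
       + p1%:~R * (p12 * q1)%:~R * l1%:R / ((q12 * p1)%:~R * q1%:~R) * m%:~R : R)
        \is a Num.int) ->
    (forall n m : int,
      (l2%:R ^+ 2 * p2%:~R / q2%:~R + 2 * p2%:~R * l2%:R / q2%:~R * m%:~R
       + p2%:~R * (p12 * q2)%:~R * l2%:R / ((q12 * p2)%:~R * q2%:~R) * n%:~R : R)
        \is a Num.int) ->
    T1 != 0 -> T2 != 0 ->
    Tf / S1 = p1%:~R / q1%:~R -> Tf / S2 = p2%:~R / q2%:~R ->
    Tf / S12 = p12%:~R / q12%:~R ->
    `|S1^-1| <= B -> `|S2^-1| <= B -> `|S12^-1| <= B -> 0 <= t ->
    (forall i, 0 <= w i) -> (forall A, partial_sum w A <= 1) ->
    (forall A, partial_sum (fun nm => w nm *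
      ((nm.1%:R - n0%:R) ^+ 2 + (nm.2%:R - m0%:R) ^+ 2)) A <= M) ->
  `| csum2 (fun nm => (w nm)%:C%C * expi (- (2 * pi * (t + Tf) *
        ((nm.1%:R - n0%:R) / T1 + (nm.2%:R - m0%:R) / T2 +
         (nm.1%:R - n0%:R) ^+ 2 / S1 + (nm.2%:R - m0%:R) ^+ 2 / S2 +
         (nm.1%:R - n0%:R) * (nm.2%:R - m0%:R) / S12)))) -
     \sum_(k1 < l1) \sum_(k2 < l2)
       expi (- (2 * pi * k1%:R * n0%:R / l1%:R)) *
       expi (- (2 * pi * k2%:R * m0%:R / l2%:R)) *
       inner l1 l2 (theta R p1 q1 p2 q2 p12 q12 n0 m0) (phi R l1 l2 k1 k2) *
       csum2 (fun nm => (w nm)%:C%C * expi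
         (- (2 * pi * (t + Tf + k1%:R / l1%:R * T1) * ((nm.1%:R - n0%:R) / T1))
          - 2 * pi * (t + Tf + k2%:R / l2%:R * T2) * ((nm.2%:R - m0%:R) / T2))) |
  <= (4 * pi * t * B * M)%:C%C.
Proof.
move=> p1n0 q1n0 p2n0 q2n0 q12n0 l10 l20 per1 per2 T10 T20 r1 r2 r12 S1B S2B S12B
  t0 w0 w1 wM.
have pi0 : 0 < pi :> R := pi_gt0 R.
have l1R : l1%:R != 0 :> R by rewrite pnatr_eq0 -lt0n.
have l2R : l2%:R != 0 :> R by rewrite pnatr_eq0 -lt0n.
pose th := theta R p1 q1 p2 q2 p12 q12 n0 m0.
have th1 n m : th (n + l1%:Z) m = th n m by exact: theta_periodicl.
have th2 n m : th n (m + l2%:Z) = th n m by exact: theta_periodicr.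
have thE (n m : nat) := fourier_inversion n m l10 l20 th1 th2.
apply: norm_csum2_combination_le.
- exact: packet_sum_cvg w0 w1.
- by move=> j1 j2; exact: packet_sum_cvg w0 w1.
move=> A.
pose dn (nm : nat * nat) : R := nm.1%:R - n0%:R.
pose dm (nm : nat * nat) : R := nm.2%:R - m0%:R.
pose Q nm : R := dn nm ^+ 2 / S1 + dm nm ^+ 2 / S2 + dn nm * dm nm / S12.
pose a nm : R := - (2 * pi * (t + Tf) * (dn nm / T1 + dm nm / T2)).
(* An exact identity at each lattice point: the whole discrepancy is the factor
   [expi (- (2 pi t Q)) - 1]. *)
have termE nm : (w nm)%:C%C * expi (- (2 * pi * (t + Tf) *
      (dn nm / T1 + dm nm / T2 + dn nm ^+ 2 / S1 + dm nm ^+ 2 / S2 +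
       dn nm * dm nm / S12))) -
    \sum_(k1 < l1) \sum_(k2 < l2)
       expi (- (2 * pi * k1%:R * n0%:R / l1%:R)) *
       expi (- (2 * pi * k2%:R * m0%:R / l2%:R)) *
       inner l1 l2 th (phi R l1 l2 k1 k2) *
       ((w nm)%:C%C * expi
         (- (2 * pi * (t + Tf + k1%:R / l1%:R * T1) * (dn nm / T1))
          - 2 * pi * (t + Tf + k2%:R / l2%:R * T2) * (dm nm / T2))) =
    (w nm)%:C%C * (expi (a nm) * th nm.1 nm.2 *
      (expi (- (2 * pi * t * Q nm)) - 1)).
  (* By the resonance relations, the quadratic terms multiplied by [Tf] become the rational phase of
     [theta]; those multiplied by [t] form [Q]. *)
  have -> : - (2 * pi * (t + Tf) *
      (dn nm / T1 + dm nm / T2 + dn nm ^+ 2 / S1 + dm nm ^+ 2 / S2 +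
       dn nm * dm nm / S12)) = a nm +
     - (2 * pi * (p1%:~R / q1%:~R * dn nm ^+ 2 +
        p12%:~R / q12%:~R * (dn nm * dm nm) + p2%:~R / q2%:~R * dm nm ^+ 2)) +
     - (2 * pi * t * Q nm) by rewrite /a /Q -r1 -r2 -r12; ring.
  rewrite !expiD -[expi (- (2 * pi * (_ + _ + _)))]/(th nm.1 nm.2).
  rewrite mulrBr mulr1 mulrBr; congr (_ - _).
  rewrite -[in RHS]thE !mulr_sumr; apply: eq_bigr => k1 _.
  rewrite !mulr_sumr; apply: eq_bigr => k2 _.
  (* Each shift of a classical time turns the phase by [k (n - n0) / l]: the part in [n] is the
     character [phi], and the part in [n0] cancels against the prefactor of the coefficient. *)
  have -> : - (2 * pi * (t + Tf + k1%:R / l1%:R * T1) * (dn nm / T1))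
      - 2 * pi * (t + Tf + k2%:R / l2%:R * T2) * (dm nm / T2) = a nm +
      (2 * pi * k1%:R * n0%:R / l1%:R) + (2 * pi * k2%:R * m0%:R / l2%:R) +
      - (2 * pi * k1%:R * nm.1%:R / l1%:R) + - (2 * pi * k2%:R * nm.2%:R / l2%:R).
    by rewrite /a /dn /dm; field; rewrite T10 T20 l1R l2R.
  rewrite /phi !expiD -!pmulrn.
  have cancel (x : R) : expi (- x) * expi x = 1 by rewrite -expiD addNr expi0.
  set e1 := expi (- (2 * pi * k1%:R * n0%:R / l1%:R)).
  set e2 := expi (- (2 * pi * k2%:R * m0%:R / l2%:R)).
  set e1' := expi (2 * pi * k1%:R * n0%:R / l1%:R).
  set e2' := expi (2 * pi * k2%:R * m0%:R / l2%:R).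
  have c1 : e1 * e1' = 1 by exact: cancel.
  have c2 : e2 * e2' = 1 by exact: cancel.
  set b := inner _ _ _ _; set f1 := expi _; set f2 := expi _.
  set f3 := expi _; set W := _%:C%C.
  transitivity ((e1 * e1') * (e2 * e2') * (W * (f1 * (b * (f2 * f3))))).
    by ring.
  by rewrite c1 c2 !mul1r.
under eq_bigr do rewrite termE.
apply: (le_trans (ler_norm_sum _ _ _)).
have B0 : 0 <= B := le_trans (normr_ge0 _) S1B.
have Bt : 0 <= 4 * pi * t * B.
  by apply: mulr_ge0 => //; apply: mulr_ge0 => //; rewrite mulr_ge0 ?(ltW pi0).
apply: (@le_trans _ _ (\sum_(i : A) (4 * pi * t * B * (w (val i) *
   (dn (val i) ^+ 2 + dm (val i) ^+ 2)))%:C%C)); last first.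
  rewrite -rmorph_sum /= lecR -mulr_sumr ler_wpM2l //; exact: wM.
apply: ler_sum => i _; move: (val i) => nm.
rewrite !normrM !norm_expi !mul1r.
rewrite [X in X * _]ger0_norm ?ler0c ?w0 //.
apply: (@le_trans _ _ ((w nm)%:C%C * (`|- (2 * pi * t * Q nm)|)%:C%C)).
  by rewrite ler_wpM2l ?ler0c // norm_expi_sub1_le.
rewrite -rmorphM /= lecR mulrCA ler_wpM2l // normrN !normrM.
rewrite (ger0_norm (ltW pi0)) (ger0_norm t0) (ger0_norm (ler0n _ 2)).
have -> : 4 * pi * t * B * (dn nm ^+ 2 + dm nm ^+ 2) =
  2 * pi * t * (2 * B * (dn nm ^+ 2 + dm nm ^+ 2)) by ring.
rewrite ler_wpM2l ?mulr_ge0 ?(ltW pi0) //.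
rewrite /Q; apply: (le_trans (ler_normD _ _)).
(* The pure squares and the cross term each cost [B (dn^2 + dm^2)], the latter by
   [|dn dm| <= dn^2 + dm^2]; hence the factor 2. *)
have n1 : `|dn nm ^+ 2 / S1 + dm nm ^+ 2 / S2| <= B * (dn nm ^+ 2 + dm nm ^+ 2).
  apply: (le_trans (ler_normD _ _)); rewrite mulrDr.
  rewrite (normrM (dn nm ^+ 2)) (normrM (dm nm ^+ 2)).
  by rewrite !(ger0_norm (sqr_ge0 _)) lerD // mulrC ler_wpM2r ?sqr_ge0.
have n2 : `|dn nm * dm nm / S12| <= B * (dn nm ^+ 2 + dm nm ^+ 2).
  rewrite normrM mulrC ler_pM // normrM -(real_normK (num_real (dn nm))).
  rewrite -(real_normK (num_real (dm nm))).
  by have := normr_ge0 (dn nm); have := normr_ge0 (dm nm); nra.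
lra.
Qed.

End Revival.

(** * Assembly of the estimates as [h] tends to 0 *)

Theorem theorem4p16 (R : realType)
  (omega1 omega2 : R) (F : {poly {poly R}}) (E1 E2 : R)
  (delta1 delta2 delta1' delta2' : R) (chi : R * R -> R)
  (n0 m0 : R -> nat)
  (p1 q1 p2 q2 p12 q12 : int) (Tfrac : R -> R) (l1 l2 : nat) (alpha : R)
  (homega1 : 0 < omega1) (homega2 : 0 < omega2)
  (hE1 : 0 < E1 <= 1) (hE2 : 0 < E2 <= 1)
  (hdelta1 : 0 < delta1) (hdelta11' : delta1 < delta1') (hdelta1' : delta1' < 1)
  (hdelta2 : 0 < delta2) (hdelta22' : delta2 < delta2') (hdelta2' : delta2' < 1)
  (hchi : schwartz chi) (hchi_ge0 : forall x, 0 <= chi x)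
  (hchi_neq0 : exists x, chi x != 0)
  (hFX : (partialX F).[E1, E2] != 0)
  (hFY : (partialY F).[E1, E2] != 0)
  (hFXX : (partialX (partialX F)).[E1, E2] != 0)
  (hFXY : (partialX (partialY F)).[E1, E2] != 0)
  (hFYY : (partialY (partialY F)).[E1, E2] != 0)
  (hp1 : p1 != 0) (hq1 : q1 != 0) (hp2 : p2 != 0) (hq2 : q2 != 0)
  (hp12 : p12 != 0) (hq12 : q12 != 0)
  (hTfrac1 : forall h, 0 < h ->
    p1%:~R / q1%:~R * Trev1 omega1 F E1 E2 h = Tfrac h)
  (hTfrac2 : forall h, 0 < h ->
    p2%:~R / q2%:~R * Trev2 omega2 F E1 E2 h = Tfrac h)
  (hTfrac12 : forall h, 0 < h ->
    p12%:~R / q12%:~R * Trev12 omega1 omega2 F E1 E2 h = Tfrac h)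
  (hl1 : (0 < l1)%N) (hl2 : (0 < l2)%N)
  (hper1 : let r1 := p12 * q1 in let s1 := q12 * p1 in
    forall n m : int,
      (l1%:R ^+ 2 * p1%:~R / q1%:~R
       + 2 * p1%:~R * l1%:R / q1%:~R * n%:~R
       + p1%:~R * r1%:~R * l1%:R / (s1%:~R * q1%:~R) * m%:~R : R)
        \is a Num.int)
  (hper2 : let r2 := p12 * q2 in let s2 := q12 * p2 in
    forall n m : int,
      (l2%:R ^+ 2 * p2%:~R / q2%:~R
       + 2 * p2%:~R * l2%:R / q2%:~R * m%:~R
       + p2%:~R * r2%:~R * l2%:R / (s2%:~R * q2%:~R) * n%:~R : R)
        \is a Num.int)
  (halpha : 1 - 2 * Num.min delta1 delta2 < alpha) :
  exists c : R -> 'I_l1 -> 'I_l2 -> R[i],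
    (exists C : R, \forall h \near 0^'+,
       (* the nearest indices exist but need not be unique for every small h *)
       unique_nearest omega1 h E1 (n0 h) ->
       unique_nearest omega2 h E2 (m0 h) ->
       forall t : R, 0 <= t <= h `^ alpha ->
         `| a2 omega1 omega2 F E1 E2 delta1' delta2' chi h (n0 h) (m0 h)
              (t + Tfrac h)
            - \sum_(k1 < l1) \sum_(k2 < l2) c h k1 k2 *
                psi_cl omega1 omega2 F delta1' delta2' chi h (n0 h) (m0 h)
                  (t + Tfrac h + k1%:R / l1%:R *
                     Tscl1 omega1 omega2 F h (n0 h) (m0 h))
                  (t + Tfrac h + k2%:R / l2%:R *
                     Tscl2 omega1 omega2 F h (n0 h) (m0 h)) |
         <= (C * h `^ (alpha + 2 * Num.min delta1 delta2 - 1))%:C%C) /\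
    (forall h (k1 : 'I_l1) (k2 : 'I_l2), 0 < h ->
       c h k1 k2 =
         expi (- (2 * pi * k1%:R * (n0 h)%:R / l1%:R)) *
         expi (- (2 * pi * k2%:R * (m0 h)%:R / l2%:R)) *
         inner l1 l2 (theta R p1 q1 p2 q2 p12 q12 (n0 h) (m0 h))
                     (phi R l1 l2 k1 k2)).
Proof.
have [E10 _] := andP hE1; have [E20 _] := andP hE2.
have [C CP] := packet_moments homega1 homega2 E10 E20
  (introT andP (conj hdelta1 hdelta11')) hdelta1'
  (introT andP (conj hdelta2 hdelta22')) hdelta2' hchi hchi_ge0 hchi_neq0.
exists (fun h k1 k2 => expi (- (2 * pi * k1%:R * (n0 h)%:R / l1%:R)) *
         expi (- (2 * pi * k2%:R * (m0 h)%:R / l2%:R)) *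
         inner l1 l2 (theta R p1 q1 p2 q2 p12 q12 (n0 h) (m0 h))
                     (phi R l1 l2 k1 k2)); split; last by [].
have pi0 : 0 < pi :> R := pi_gt0 R.
(* Inverse revival periods divided by [h]. Their independence of [h] gives the bound [h * kap] on
   all three inverse periods. *)
pose k1 := omega1 ^+ 2 * (partialX (partialX F)).[E1, E2] / (4 * pi).
pose k2 := omega2 ^+ 2 * (partialY (partialY F)).[E1, E2] / (4 * pi).
pose k12 := omega1 * omega2 * (partialX (partialY F)).[E1, E2] / (4 * pi).
pose kap := `|k1| + `|k2| + `|k12|.
exists (4 * pi * kap * C).
near=> h => un um t /andP[t0 th].
have h0 : 0 < h by near: h; exact: nbhs_right_gt.
pose w := packet_weight omega1 omega2 delta1' delta2' chi h (n0 h) (m0 h).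
have wP : forall A, partial_sum w A <= 1 /\ partial_sum (fun nm => w nm *
    ((nm.1%:R - (n0 h)%:R) ^+ 2 + (nm.2%:R - (m0 h)%:R) ^+ 2)) A <=
    C * h `^ (2 * Num.min delta1 delta2 - 2).
  (* The indices depend on [h]; they are generalized so that the bound, uniform over all nearest
     indices, can be read off near 0. *)
  by rewrite /w; move: (n0 h) (m0 h) un um; near: h; exact: CP.
have FX0 : (partialX F).[level omega1 h (n0 h)%:Z, level omega2 h (m0 h)%:Z] != 0.
  move: (n0 h) (m0 h) un um {w wP}; near: h.
  exact: (horner2_level_neq0 homega1 homega2 E10 E20 hFX).
have FY0 : (partialY F).[level omega1 h (n0 h)%:Z, level omega2 h (m0 h)%:Z] != 0.
  move: (n0 h) (m0 h) un um {w wP FX0}; near: h.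
  exact: (horner2_level_neq0 homega1 homega2 E10 E20 hFY).
have hTs1 : Tscl1 omega1 omega2 F h (n0 h) (m0 h) != 0.
  by rewrite /Tscl1 !mulf_neq0 ?invr_neq0 ?mulf_neq0 ?(gt_eqF pi0) ?(gt_eqF homega1).
have hTs2 : Tscl2 omega1 omega2 F h (n0 h) (m0 h) != 0.
  by rewrite /Tscl2 !mulf_neq0 ?invr_neq0 ?mulf_neq0 ?(gt_eqF pi0) ?(gt_eqF homega2).
have iTr1 : (Trev1 omega1 F E1 E2 h)^-1 = h * k1.
  by rewrite /Trev1 /k1 invf_div; ring.
have iTr2 : (Trev2 omega2 F E1 E2 h)^-1 = h * k2.
  by rewrite /Trev2 /k2 invf_div; ring.
have iTr12 : (Trev12 omega1 omega2 F E1 E2 h)^-1 = h * k12.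
  by rewrite /Trev12 /k12 invf_div; ring.
have unitK (x k : R) : x^-1 = h * k -> k != 0 -> x != 0.
  by move=> xk k0; rewrite -invr_eq0 xk mulf_neq0 // gt_eqF.
have o12 : omega1 != 0 /\ omega2 != 0 by rewrite !gt_eqF.
have r1 : Tfrac h / Trev1 omega1 F E1 E2 h = p1%:~R / q1%:~R.
  rewrite -hTfrac1 // mulfK // (unitK _ _ iTr1) //.
  by rewrite !mulf_neq0 ?invr_neq0 ?mulf_neq0 ?expf_neq0 ?o12.1 ?(gt_eqF pi0).
have r2 : Tfrac h / Trev2 omega2 F E1 E2 h = p2%:~R / q2%:~R.
  rewrite -hTfrac2 // mulfK // (unitK _ _ iTr2) //.
  by rewrite !mulf_neq0 ?invr_neq0 ?mulf_neq0 ?expf_neq0 ?o12.2 ?(gt_eqF pi0).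
have r12 : Tfrac h / Trev12 omega1 omega2 F E1 E2 h = p12%:~R / q12%:~R.
  rewrite -hTfrac12 // mulfK // (unitK _ _ iTr12) //.
  by rewrite !mulf_neq0 ?invr_neq0 ?mulf_neq0 ?o12.1 ?o12.2 ?(gt_eqF pi0).
have kapB (k : R) : `|k| <= kap -> `|h * k| <= h * kap.
  by move=> kk; rewrite normrM gtr0_norm // ler_pM2l.
have [[kn1 kn2] kn12] := (normr_ge0 k1, normr_ge0 k2, normr_ge0 k12).
have B1 : `|(Trev1 omega1 F E1 E2 h)^-1| <= h * kap.
  by rewrite iTr1 kapB // /kap; lra.
have B2 : `|(Trev2 omega2 F E1 E2 h)^-1| <= h * kap.
  by rewrite iTr2 kapB // /kap; lra.
have B12 : `|(Trev12 omega1 omega2 F E1 E2 h)^-1| <= h * kap.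
  by rewrite iTr12 kapB // /kap; lra.
have w0 nm : 0 <= w nm by exact: sqr_ge0.
apply: (le_trans (revival_expansion hp1 hq1 hp2 hq2 hq12 hl1 hl2 hper1 hper2
  hTs1 hTs2 r1 r2 r12 B1 B2 B12 t0 w0 (fun A => (wP A).1) (fun A => (wP A).2))).
rewrite lecR.
have C0 : 0 <= C * h `^ (2 * Num.min delta1 delta2 - 2).
  apply: le_trans (wP fset0).2; apply: sumr_ge0 => i.
  by rewrite mulr_ge0 ?addr_ge0 ?sqr_ge0.
(* The exponents add up as [alpha + 1 + (2 min - 2)]: one from the duration [t], one from the
   inverse revival periods, one from the second moment. *)
have -> : 4 * pi * kap * C * h `^ (alpha + 2 * Num.min delta1 delta2 - 1) =
  4 * pi * h `^ alpha * (h * kap) * (C * h `^ (2 * Num.min delta1 delta2 - 2)).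
  have -> : h `^ (alpha + 2 * Num.min delta1 delta2 - 1) =
     h `^ alpha * h * h `^ (2 * Num.min delta1 delta2 - 2).
    rewrite -[X in _ * X * _]powRr1 ?(ltW h0) // -!powRD ?(gt_eqF h0) ?implybT //.
    by congr powR; ring.
  by ring.
have kap0 : 0 <= kap by rewrite !addr_ge0.
rewrite ler_wpM2r // ler_wpM2r ?mulr_ge0 ?(ltW h0) // ler_wpM2l //.
by rewrite mulr_ge0 ?(ltW pi0).
Unshelve. all: by end_near.
Qed.
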